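(* Let $c\in(0,3]$ and $f\in\mathcal{F}(c)$. Then the logarithmic coefficients $\gamma_n$ of $f$ satisfy $$|\gamma_1|\leq \frac{c}{4},\qquad |\gamma_2|\leq \frac{1}{48}(4c+c^2),\qquad |\gamma_3|\leq \frac{1}{48}(2c+c^2),$$ $$|\gamma_4|\leq \begin{cases}\dfrac{1}{40}\left[c+\dfrac{c^2}{18}\left(13+\dfrac{c}{2}-\dfrac{c^2}{8}\right)\right] & \text{if } 0<c\le \frac{144}{55},\\[3mm] \dfrac{1}{40}\left[c+\dfrac{2c^2}{9}+\dfrac{c^2}{2}M_2(c)\right] & \text{if } c\in(2.71569,3],\end{cases}$$ and $$|\gamma_5|\leq \begin{cases}\dfrac{1}{60}\left[c+\dfrac{c^2}{12}\left(11+c-\dfrac{c^2}{4}\right)\right] & \text{if } 0<c\le \frac{80}{61},\\[3mm] \dfrac{1}{60}\left[c+\dfrac{c^2}{2}+\dfrac{c^3}{24}+\dfrac{5c^2}{12}M_3(c)\right] & \text{if } c\in(1.35541,3],\end{cases}$$ where $$M_2(c)=\frac{54+c}{27}\left(\frac{4(54+c)}{3(288+8c-c^2)}\right)^{1/2},\qquad M_3(c)=\frac{30+c}{15}\left(\frac{2(30+c)}{3(80+4c-c^2)}\right)^{1/2}.$$ The first three inequalities are sharp, with equality for the function $$f_c(z)=\begin{cases}\dfrac{(1-z)^{1-c}-1}{c-1} & \text{if } c\neq 1,\\[2mm] -\log(1-z) & \text{if } c=1,\end{cases}$$ which belongs to $\mathcal{F}(c)$. Moreover, the bound for $|\gamma_4|$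 is sharp (i.e. it is the best possible upper bound over $\mathcal{F}(c)$) for $c\le 144/55$, and the bound for $|\gamma_5|$ is sharp for $c\le 80/61$.
   Context: $\mathbb{D}=\{z\in\mathbb{C}:|z|<1\}$. $\mathcal{A}$ is the class of analytic functions $f$ on $\mathbb{D}$ with $f(0)=f'(0)-1=0$. For $c\in(0,3]$, $$\mathcal{F}(c)=\left\{f\in\mathcal{A}:\ \mathrm{Re}\left(1+\frac{zf''(z)}{f'(z)}\right)>1-\frac{c}{2},\ z\in\mathbb{D}\right\}$$ (in particular $zf''/f'$ is analytic in $\mathbb{D}$). Functions in $\mathcal{F}(c)$, $c\in(0,3]$, are known to be univalent, so $f(z)/z$ is nonvanishing in $\mathbb{D}$. The logarithmic coefficients $\gamma_n=\gamma_n(f)$ are defined by $\log\frac{f(z)}{z}=2\sum_{n=1}^\infty\gamma_n z^n$ for $z\in\mathbb{D}$, with the branch of the logarithm vanishing at $z=0$. Powers and logarithms of $1-z$ are principal branches. *)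

(* Defs.v *)
From Stdlib Require Import Reals.
From Coquelicot Require Import Coquelicot.

Open Scope R_scope.

(** Functions on the unit disk are total maps [C -> C]; only their values on
    the disk are ever constrained (the disk is open, so derivatives and local
    expansions at its points do not see the values outside). *)
Definition in_disk (z : C) : Prop := Cmod z < 1.

Definition analytic_on_disk (f : C -> C) : Prop :=
  forall z0 : C, in_disk z0 ->
  exists (a : nat -> C) (r : R), 0 < r /\
    forall z : C, Cmod (z - z0)%C < r ->
      @is_pseries C_AbsRing C_NormedModule a (z - z0)%C (f z).

Definition class_A (f : C -> C) : Prop :=
  analytic_on_disk f /\ f (RtoC 0) = RtoC 0 /\ C_derive f (RtoC 0) = RtoC 1.

(** The nonvanishing of [f'] is part of the definition: [z f''/f'] has to be
    analytic in the disk, whereas division in Rocq is total.  [C_derive] is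
    the complex derivative wherever one exists ([is_C_derive_unique]), hence
    for [f] and [f'] at every point of the disk, by analyticity. *)
Definition class_F (c : R) (f : C -> C) : Prop :=
  class_A f /\
  forall z : C, in_disk z ->
    C_derive f z <> RtoC 0 /\
    Re (1 + z * C_derive (C_derive f) z / C_derive f z)%C > 1 - c / 2.

Definition Cexp (z : C) : C :=
  (exp (Re z) * cos (Im z), exp (Re z) * sin (Im z)).

(** Principal argument, with values in (-PI, PI] for [w <> 0]. *)
Definition Carg (w : C) : R :=
  if Rle_dec 0 (Im w) then acos (Re w / Cmod w) else - acos (Re w / Cmod w).

(** Principal logarithm and powers, meaningful for [w <> 0]. *)
Definition Clog (w : C) : C := (ln (Cmod w), Carg w).

Definition Cpower (w a : C) : C := Cexp (a * Clog w)%C.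

(** [L] is the branch of [log (f z / z)] on the disk vanishing at 0.  For [f]
    in [class_A], [f z / z] extends by [f' 0 = 1 = Cexp (L 0)] to [z = 0]. *)
Definition is_log_branch (f L : C -> C) : Prop :=
  (forall z : C, in_disk z -> continuous L z) /\
  L (RtoC 0) = RtoC 0 /\
  forall z : C, in_disk z -> z <> RtoC 0 -> Cexp (L z) = (f z / z)%C.

(** Logarithmic coefficients [gamma 1, gamma 2, ...]; [gamma 0] is unused. *)
Definition is_log_coeffs (f : C -> C) (gamma : nat -> C) : Prop :=
  exists L : C -> C, is_log_branch f L /\
    forall z : C, in_disk z ->
      @is_series C_AbsRing C_NormedModule
        (fun n : nat => 2 * (gamma (S n) * z ^ S n))%C (L z).

Definition log_coeff_moduli (c : R) (n : nat) (x : R) : Prop :=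
  exists (f : C -> C) (gamma : nat -> C),
    class_F c f /\ is_log_coeffs f gamma /\ x = Cmod (gamma n).

Definition M2 (c : R) : R :=
  (54 + c) / 27 * sqrt (4 * (54 + c) / (3 * (288 + 8 * c - c ^ 2))).

Definition M3 (c : R) : R :=
  (30 + c) / 15 * sqrt (2 * (30 + c) / (3 * (80 + 4 * c - c ^ 2))).

Definition f_extremal (c : R) (z : C) : C :=
  if Req_EM_T c 1 then (- Clog (1 - z))%C
  else ((Cpower (1 - z) (1 - c) - 1) / (c - 1))%C.

(* Main.v *)
Require Import Defs.
From Stdlib Require Import Reals Lra Lia.
From Coquelicot Require Import Coquelicot.

Open Scope R_scope.

(** Let [L] be the logarithm of [f z / z], so that [f = z exp L], and put
    [q = z f' / f = 1 + z L']. Then [z f'' / f' = (q - 1) + z q' / q]. For [f]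
    in the class this function equals [c] times a function [s] with [s 0 = 0]
    and [Re (1 + 2 s) > 0]. Let [a n] be the Taylor coefficients of [s].
    Comparing coefficients in [(c s - (q - 1)) q = z q'] expresses the
    logarithmic coefficients as polynomials in [a 1, ..., a 5]
    ([log_coeff_formulas]); for the extremal function [s = z / (1 - z)] and
    every [a n] is 1.

    Since [Re (1 + 2 s)] is positive with mean 1 on circles, the [a n] are the
    moments of probability measures on the unit circle (after a radial limit).
    The covariance of two powers of the coordinate is at most half the sum of
    their variances, which gives [|a (m + n) - a m a n| <= 1 - |a m| |a n|]
    and in particular [|a n| <= 1] ([positive_real_part_covariance]). The
    first three estimates are then the triangle inequality. In the formulas
    for the fourth and fifth coefficient the only negative terms are those in
    [c^4]; they are paired with terms from [c^3], as in [a 2 - (c / 4) (a 1)^2], whose modulus is at most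
    [1 - (c / 4) |a 1|^2] by the covariance inequality. What remains is an
    increasing function of [|a 1|] and [|a 2|] on the unit square, so its
    maximum is the value with all moduli equal to 1, the one attained by the
    extremal function ([gamma4_bound], [gamma5_bound]). The bounds with [M2]
    and [M3] follow because they are weaker than these polynomial bounds on
    their ranges ([M2_ge], [M3_ge]).

    The function [s] is only known to be holomorphic in the disk, and its
    coefficients have to be computed from its values on large circles. This is
    Cauchy's theorem: a function with a continuous complex derivative in the
    disk is the sum of a power series there ([holo_power_series]). It is
    proved by contracting a circle to an interior point and differentiating
    under the integral sign. The same theorem gives the expansion of the
    logarithm for the extremal function, as the primitive of a logarithmic
    derivative, and the local expansions required for analyticity. *)

(** * Complex derivatives *)

Notation is_cderive := (@is_derive C_AbsRing C_NormedModule) (only parsing).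

Lemma Cmod_minus_sym (x y : C) : Cmod (x - y)%C = Cmod (y - x)%C.
Proof. rewrite <- Cmod_opp; f_equal; ring. Qed.

Lemma is_cderive_eps (f : C -> C) (z l : C) :
  is_cderive f z l <->
  forall eps, 0 < eps -> exists delta, 0 < delta /\
    forall y, Cmod (y - z)%C < delta ->
      Cmod (f y - f z - (y - z) * l)%C <= eps * Cmod (y - z)%C.
Proof.
  split.
  - intros [_ H] eps Heps.
    destruct (H z (fun P HP => HP) (mkposreal eps Heps)) as [d Hd].
    exists d; split; [apply cond_pos|].
    intros y Hy; apply Hd, Hy.
  - intros H; split; [apply is_linear_scal_l|].
    intros x Hx.
    assert (E : z = x) by exact (@is_filter_lim_locally_unique C_AbsRing (AbsRing_NormedModule C_AbsRing) z x Hx).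
    subst x; intros eps.
    destruct (H eps (cond_pos eps)) as [d [Hd Hy]].
    exists (mkposreal d Hd); intros y Hyz; apply Hy, Hyz.
Qed.

Lemma continuous_C_eps (f : C -> C) (z : C) :
  @continuous C_UniformSpace C_UniformSpace f z <->
  forall eps, 0 < eps -> exists delta, 0 < delta /\
    forall y, Cmod (y - z)%C < delta -> Cmod (f y - f z)%C < eps.
Proof.
  split.
  - intros H eps Heps.
    assert (Hl : @locally C_UniformSpace (f z) (fun w => Cmod (w - f z)%C < eps)).
    { apply locally_C; exists (mkposreal eps Heps); intros w Hw; exact Hw. }
    specialize (H _ Hl); apply locally_C in H; destruct H as [d Hd].
    exists d; split; [apply cond_pos|]. intros y Hy; apply Hd, Hy.
  - intros H P HP; apply locally_C in HP; destruct HP as [e He].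
    destruct (H e (cond_pos e)) as [d [Hd Hy]].
    apply locally_C; exists (mkposreal d Hd); intros y Hyz; apply He, Hy, Hyz.
Qed.

Lemma is_cderive_continuous (f : C -> C) (z l : C) :
  is_cderive f z l -> @continuous C_UniformSpace C_UniformSpace f z.
Proof.
  intros H P HP.
  apply locally_C, (@ex_derive_continuous C_AbsRing C_NormedModule f z); [exists l; exact H|exact HP].
Qed.

(** The field of complex numbers is a normed space over itself in two ways,
    with the same norm but different families of balls; products and
    compositions of derivatives are available for one, the derivative is taken
    in the other. *)
Lemma is_cderive_ring (f : C -> C) (z l : C) :
  @is_derive C_AbsRing (AbsRing_NormedModule C_AbsRing) f z l <-> is_cderive f z l.
Proof.
  split; intros [_ H]; (split; [apply is_linear_scal_l|exact H]).
Qed.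

Lemma is_cderive_const (k z : C) : is_cderive (fun _ => k) z (RtoC 0).
Proof. apply (@is_derive_const C_AbsRing C_NormedModule). Qed.

Lemma is_cderive_id (z : C) : is_cderive (fun w => w) z (RtoC 1).
Proof. apply is_cderive_ring, (@is_derive_id C_AbsRing). Qed.

Lemma is_cderive_plus (f g : C -> C) (z df dg : C) :
  is_cderive f z df -> is_cderive g z dg ->
  is_cderive (fun w => f w + g w)%C z (df + dg)%C.
Proof. apply (@is_derive_plus C_AbsRing C_NormedModule). Qed.

Lemma is_cderive_opp (f : C -> C) (z df : C) :
  is_cderive f z df -> is_cderive (fun w => - f w)%C z (- df)%C.
Proof. apply (@is_derive_opp C_AbsRing C_NormedModule). Qed.

Lemma is_cderive_minus (f g : C -> C) (z df dg : C) :
  is_cderive f z df -> is_cderive g z dg ->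
  is_cderive (fun w => f w - g w)%C z (df - dg)%C.
Proof. apply (@is_derive_minus C_AbsRing C_NormedModule). Qed.

Lemma is_cderive_mult (f g : C -> C) (z df dg : C) :
  is_cderive f z df -> is_cderive g z dg ->
  is_cderive (fun w => f w * g w)%C z (df * g z + f z * dg)%C.
Proof.
  intros Hf Hg; apply is_cderive_ring in Hf, Hg.
  apply is_cderive_ring, (@is_derive_mult C_AbsRing f g z df dg Hf Hg).
  exact Cmult_comm.
Qed.

Lemma is_cderive_comp (f g : C -> C) (z df dg : C) :
  is_cderive f (g z) df -> is_cderive g z dg ->
  is_cderive (fun w => f (g w)) z (dg * df)%C.
Proof. intros Hf Hg; apply is_cderive_ring in Hg.
  apply (@is_derive_comp C_AbsRing C_NormedModule f g z df dg Hf Hg). Qed.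

Lemma is_cderive_eq (f : C -> C) (z l l' : C) :
  is_cderive f z l' -> l' = l -> is_cderive f z l.
Proof. intros H <-; exact H. Qed.

Lemma is_cderive_inv (z : C) :
  z <> RtoC 0 -> is_cderive (fun w => / w)%C z (- (/ z * / z))%C.
Proof.
  intros Hz; apply is_cderive_eps; intros eps Heps.
  assert (Hm : 0 < Cmod z) by now apply Cmod_gt_0.
  exists (Rmin (Cmod z / 2) (eps * (Cmod z) ^ 3 / 2)); split.
  { apply Rmin_pos; [lra|]. apply Rdiv_lt_0_compat; [|lra].
    apply Rmult_lt_0_compat; [exact Heps|now apply pow_lt]. }
  intros y Hy.
  assert (H1 := Rlt_le_trans _ _ _ Hy (Rmin_l _ _)).
  assert (H2 := Rlt_le_trans _ _ _ Hy (Rmin_r _ _)).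
  assert (Hym : Cmod z / 2 <= Cmod y).
  { assert (T := Cmod_triangle y (z - y)%C).
    replace (y + (z - y))%C with z in T by ring.
    rewrite Cmod_minus_sym in T. lra. }
  assert (Hy0 : y <> RtoC 0) by (apply Cmod_gt_0; lra).
  replace (/ y - / z - (y - z) * - (/ z * / z))%C
    with ((y - z) * ((y - z) * / (y * (z * z))))%C by (field; auto).
  rewrite !Cmod_mult, Cmod_inv, !Cmod_mult by (repeat apply Cmult_neq_0; auto).
  rewrite (Rmult_comm eps).
  apply Rmult_le_compat_l; [apply Cmod_ge_0|].
  set (d := Cmod (y - z)) in *. set (m := Cmod z) in *. set (k := Cmod y) in *.
  apply Rle_div_l; [apply Rmult_lt_0_compat; [lra|nra]|].
  apply Rle_trans with (eps * m ^ 3 / 2); [lra|].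
  apply Rle_trans with (eps * (m / 2 * (m * m))); [right; field|].
  apply Rmult_le_compat_l; [lra|].
  apply Rmult_le_compat_r; nra.
Qed.

Lemma locally_disk (z : C) :
  in_disk z -> @locally (AbsRing_UniformSpace C_AbsRing) z in_disk.
Proof.
  unfold in_disk; intros Hz.
  assert (Hd : 0 < 1 - Cmod z) by lra.
  exists (mkposreal _ Hd); intros y Hy.
  change (Cmod (y - z)%C < 1 - Cmod z) in Hy.
  assert (T := Cmod_triangle (y - z) z).
  assert (E : forall u v : C, (u - v + v)%C = u) by (intros; ring).
  rewrite E in T; lra.
Qed.

Lemma is_cderive_ext_disk (f g : C -> C) (z l : C) :
  (forall w, in_disk w -> f w = g w) -> in_disk z ->
  is_cderive f z l -> is_cderive g z l.
Proof.
  intros E Hz; apply (@is_derive_ext_loc C_AbsRing C_NormedModule).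
  destruct (locally_disk z Hz) as [d Hd]; exists d; intros y Hy; apply E, Hd, Hy.
Qed.

(** * Power series *)

(** Summing the two components by real series gives a total function; under
    [disk_coeffs] it is the sum of the complex series ([CPSeries_is_series]). *)
Definition CPSeries (a : nat -> C) (z : C) : C :=
  (Series (fun n => Re (a n * z ^ n)%C), Series (fun n => Im (a n * z ^ n)%C)).

(** Radius of convergence at least 1, in the form of Abel's lemma: this bound
    passes to shifted and differentiated series without estimates of sums. *)
Definition disk_coeffs (a : nat -> C) : Prop :=
  forall rho, 0 < rho < 1 -> exists K, forall n, Cmod (a n) * rho ^ n <= K.

Lemma im_le_Cmod (z : C) : Rabs (Im z) <= Cmod z.
Proof. eapply Rle_trans; [|apply Rmax_Cmod]; apply Rmax_r. Qed.

Lemma Cmod_le_sum (z : C) : Cmod z <= Rabs (Re z) + Rabs (Im z).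
Proof.
  replace z with (RtoC (Re z) + Ci * RtoC (Im z))%C at 1
    by (destruct z; unfold RtoC, Ci, Cmult, Cplus, Re, Im; simpl; f_equal; ring).
  eapply Rle_trans; [apply Cmod_triangle|].
  rewrite Cmod_mult, Cmod_Ci, !Cmod_R; lra.
Qed.

Lemma sum_n_C (u : nat -> C) (n : nat) :
  @sum_n C_AbelianMonoid u n
  = (sum_n (fun k => Re (u k)) n, sum_n (fun k => Im (u k)) n).
Proof.
  induction n as [|n IH].
  - rewrite !sum_O; destruct (u 0%nat); reflexivity.
  - rewrite !sum_Sn, IH; destruct (u (S n)); reflexivity.
Qed.

Lemma is_series_C_iff (u : nat -> C) (l : C) :
  @is_series C_AbsRing C_NormedModule u l <->
  is_series (fun n => Re (u n)) (Re l) /\ is_series (fun n => Im (u n)) (Im l).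
Proof.
  split.
  - intros H; split; intros P [e He];
      destruct (H _ (@locally_ball C_UniformSpace l e)) as [N HN];
      exists N; intros n Hn; specialize (HN n Hn);
      apply He; rewrite sum_n_C in HN; apply HN.
  - intros [H1 H2] P [e He].
    destruct (H1 _ (locally_ball (Re l) e)) as [N1 A1].
    destruct (H2 _ (locally_ball (Im l) e)) as [N2 A2].
    exists (max N1 N2); intros n Hn; apply He; rewrite sum_n_C.
    split; [apply A1|apply A2]; lia.
Qed.

Lemma ex_series_Re_Im (u : nat -> C) :
  ex_series (fun n => Cmod (u n)) ->
  ex_series (fun n => Re (u n)) /\ ex_series (fun n => Im (u n)).
Proof.
  intros H; split; apply (@ex_series_le R_AbsRing R_CompleteNormedModule) with (2 := H);
    intros n; [apply re_le_Cmod|apply im_le_Cmod].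
Qed.

(** Comparison with a geometric series, using the bound at a radius strictly
    between [r] and 1. *)
Lemma disk_coeffs_abs (a : nat -> C) (r : R) :
  disk_coeffs a -> 0 <= r < 1 -> ex_series (fun n => Cmod (a n) * r ^ n).
Proof.
  intros Ha Hr.
  set (rho := (1 + r) / 2).
  destruct (Ha rho) as [K HK]; [unfold rho; lra|].
  apply (@ex_series_le R_AbsRing R_CompleteNormedModule) with (fun n => K * (r / rho) ^ n).
  - intros n.
    change (norm (Cmod (a n) * r ^ n)) with (Rabs (Cmod (a n) * r ^ n)).
    rewrite Rabs_pos_eq by (apply Rmult_le_pos; [apply Cmod_ge_0|apply pow_le; lra]).
    replace (Cmod (a n) * r ^ n) with (Cmod (a n) * rho ^ n * (r / rho) ^ n).
    + apply Rmult_le_compat_r; [|apply HK].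
      apply pow_le, Rdiv_le_0_compat; unfold rho; lra.
    + unfold Rdiv; rewrite Rpow_mult_distr, pow_inv. field.
      apply pow_nonzero; unfold rho; lra.
  - apply (@ex_series_scal R_AbsRing R_NormedModule), ex_series_geom.
    rewrite Rabs_pos_eq by (apply Rdiv_le_0_compat; unfold rho; lra).
    apply Rlt_div_l; unfold rho; lra.
Qed.

Lemma disk_coeffs_term_abs (a : nat -> C) (z : C) :
  disk_coeffs a -> in_disk z -> ex_series (fun n => Cmod (a n * z ^ n)%C).
Proof.
  intros Ha Hz.
  apply ex_series_ext with (fun n => Cmod (a n) * Cmod z ^ n).
  - intros n; now rewrite Cmod_mult, Cmod_pow.
  - apply disk_coeffs_abs; [exact Ha|split; [apply Cmod_ge_0|exact Hz]].
Qed.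

Lemma CPSeries_is_series (a : nat -> C) (z : C) :
  disk_coeffs a -> in_disk z ->
  @is_series C_AbsRing C_NormedModule (fun n => a n * z ^ n)%C (CPSeries a z).
Proof.
  intros Ha Hz; destruct (ex_series_Re_Im _ (disk_coeffs_term_abs a z Ha Hz)) as [H1 H2].
  apply is_series_C_iff; split; apply Series_correct; assumption.
Qed.

Lemma is_series_CPSeries (a : nat -> C) (z l : C) :
  @is_series C_AbsRing C_NormedModule (fun n => a n * z ^ n)%C l -> l = CPSeries a z.
Proof.
  intros H; apply is_series_C_iff in H; destruct H as [H1 H2].
  unfold CPSeries; rewrite (is_series_unique _ _ H1), (is_series_unique _ _ H2).
  now destruct l.
Qed.

Lemma disk_coeffs_le (a b : nat -> C) :
  disk_coeffs a -> (forall n, Cmod (b n) <= Cmod (a n)) -> disk_coeffs b.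
Proof.
  intros Ha Hb rho Hr; destruct (Ha rho Hr) as [K HK]; exists K; intros n.
  eapply Rle_trans; [apply Rmult_le_compat_r, Hb; apply pow_le; lra|apply HK].
Qed.

Lemma disk_coeffs_plus (a b : nat -> C) :
  disk_coeffs a -> disk_coeffs b -> disk_coeffs (fun n => a n + b n)%C.
Proof.
  intros Ha Hb rho Hr; destruct (Ha rho Hr) as [K HK]; destruct (Hb rho Hr) as [K' HK'].
  exists (K + K'); intros n; specialize (HK n); specialize (HK' n).
  apply Rle_trans with ((Cmod (a n) + Cmod (b n)) * rho ^ n); [|lra].
  apply Rmult_le_compat_r; [apply pow_le; lra|apply Cmod_triangle].
Qed.

Lemma disk_coeffs_scal (k : C) (a : nat -> C) :
  disk_coeffs a -> disk_coeffs (fun n => k * a n)%C.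
Proof.
  intros Ha rho Hr; destruct (Ha rho Hr) as [K HK]; exists (Cmod k * K); intros n.
  rewrite Cmod_mult, Rmult_assoc; apply Rmult_le_compat_l; [apply Cmod_ge_0|apply HK].
Qed.

Lemma disk_coeffs_shift (a : nat -> C) :
  disk_coeffs a -> disk_coeffs (fun n => a (S n)).
Proof.
  intros Ha rho Hr; destruct (Ha rho Hr) as [K HK]; exists (K / rho); intros n; cbv beta.
  apply -> Rle_div_r; [|lra]. specialize (HK (S n)); change (rho ^ S n) with (rho * rho ^ n) in HK; lra.
Qed.

(** Bernoulli's inequality for [1 / x = 1 + h]. *)
Lemma mult_INR_pow_bounded (x : R) :
  0 < x < 1 -> exists K, forall n, INR n * x ^ n <= K.
Proof.
  intros Hx; set (h := / x - 1).
  assert (Hh : 0 < h).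
  { unfold h. assert (1 < / x); [|lra]. rewrite <- Rinv_1; apply Rinv_lt_contravar; lra. }
  exists (/ h); intros n.
  assert (B := poly n h Hh).
  replace (1 + h) with (/ x) in B by (unfold h; ring).
  rewrite pow_inv in B.
  assert (Hp : 0 < x ^ n) by (apply pow_lt; lra).
  apply Rmult_le_reg_r with (h * / x ^ n); [apply Rmult_lt_0_compat; [lra|now apply Rinv_0_lt_compat]|].
  replace (INR n * x ^ n * (h * / x ^ n)) with (INR n * h) by (field; lra).
  replace (/ h * (h * / x ^ n)) with (/ x ^ n) by (field; lra).
  lra.
Qed.

Lemma disk_coeffs_INR (a : nat -> C) :
  disk_coeffs a -> disk_coeffs (fun n => RtoC (INR n) * a n)%C.
Proof.
  intros Ha rho Hr.
  set (s := (1 + rho) / 2).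
  destruct (Ha s) as [K HK]; [unfold s; lra|].
  destruct (mult_INR_pow_bounded (rho / s)) as [K' HK'].
  { split; [apply Rdiv_lt_0_compat|apply Rlt_div_l]; unfold s; lra. }
  exists (K' * K); intros n.
  rewrite Cmod_mult, Cmod_R, Rabs_pos_eq by apply pos_INR.
  replace (INR n * Cmod (a n) * rho ^ n)
    with ((INR n * (rho / s) ^ n) * (Cmod (a n) * s ^ n)).
  - apply Rmult_le_compat; auto.
    + apply Rmult_le_pos; [apply pos_INR|apply pow_le, Rdiv_le_0_compat; unfold s; lra].
    + apply Rmult_le_pos; [apply Cmod_ge_0|apply pow_le; unfold s; lra].
  - unfold Rdiv; rewrite Rpow_mult_distr, pow_inv; field.
    apply pow_nonzero; unfold s; lra.
Qed.

Lemma CPSeries_plus (a b : nat -> C) (z : C) :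
  disk_coeffs a -> disk_coeffs b -> in_disk z ->
  CPSeries (fun n => a n + b n)%C z = (CPSeries a z + CPSeries b z)%C.
Proof.
  intros Ha Hb Hz; symmetry; apply is_series_CPSeries.
  apply (@is_series_ext C_AbsRing C_NormedModule) with (fun n => plus (a n * z ^ n)%C (b n * z ^ n)%C).
  { intros n; change ((a n * z ^ n + b n * z ^ n)%C = ((a n + b n) * z ^ n)%C); ring. }
  apply (@is_series_plus C_AbsRing C_NormedModule); now apply CPSeries_is_series.
Qed.

Lemma CPSeries_scal (k : C) (a : nat -> C) (z : C) :
  disk_coeffs a -> in_disk z -> CPSeries (fun n => k * a n)%C z = (k * CPSeries a z)%C.
Proof.
  intros Ha Hz; symmetry; apply is_series_CPSeries.
  apply (@is_series_ext C_AbsRing C_NormedModule) with (fun n => scal k (a n * z ^ n)%C).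
  { intros n; change ((k * (a n * z ^ n))%C = (k * a n * z ^ n)%C); ring. }
  apply (@is_series_scal C_AbsRing C_NormedModule); now apply CPSeries_is_series.
Qed.

Lemma CPSeries_shift (a : nat -> C) (z : C) :
  disk_coeffs a -> in_disk z ->
  CPSeries a z = (a 0%nat + z * CPSeries (fun n => a (S n)) z)%C.
Proof.
  intros Ha Hz; symmetry; apply is_series_CPSeries.
  apply (@is_series_decr_1 C_AbsRing C_NormedModule).
  replace (plus _ _) with (z * CPSeries (fun n => a (S n)) z)%C.
  2:{ change (z * CPSeries (fun n => a (S n)) z
        = a 0%nat + z * CPSeries (fun n => a (S n)) z + - (a 0%nat * 1))%C; ring. }
  apply (@is_series_ext C_AbsRing C_NormedModule) with (fun n => scal z (a (S n) * z ^ n)%C).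
  { intros n; change ((z * (a (S n) * z ^ n))%C = (a (S n) * (z * z ^ n))%C); ring. }
  apply (@is_series_scal C_AbsRing C_NormedModule).
  apply CPSeries_is_series; [now apply disk_coeffs_shift|exact Hz].
Qed.

Lemma in_disk_0 : in_disk (RtoC 0).
Proof. unfold in_disk; rewrite Cmod_0; lra. Qed.

Lemma CPSeries_0 (a : nat -> C) : disk_coeffs a -> CPSeries a (RtoC 0) = a 0%nat.
Proof. intros Ha; rewrite CPSeries_shift by (auto using in_disk_0); ring. Qed.

(** The factor 2 comes from bounding the two components separately. *)
Lemma Cmod_is_series_le (u : nat -> C) (b : nat -> R) (l : C) :
  @is_series C_AbsRing C_NormedModule u l ->
  (forall n, Cmod (u n) <= b n) -> ex_series b -> Cmod l <= 2 * Series b.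
Proof.
  intros Hl Hb Hs; apply is_series_C_iff in Hl; destruct Hl as [H1 H2].
  assert (H : forall (F : C -> R) (x : R), (forall w, Rabs (F w) <= Cmod w) ->
     is_series (fun n => F (u n)) x -> Rabs x <= Series b).
  { intros F x HF Hx; rewrite <- (is_series_unique _ _ Hx).
    assert (E : ex_series (fun n => Rabs (F (u n)))).
    { apply (@ex_series_le R_AbsRing R_CompleteNormedModule) with (2 := Hs).
      intros n; change (Rabs (Rabs (F (u n))) <= b n).
      rewrite Rabs_Rabsolu; eapply Rle_trans; [apply HF|apply Hb]. }
    eapply Rle_trans; [apply Series_Rabs, E|].
    apply Series_le; [|exact Hs]. intros n; split; [apply Rabs_pos|].
    eapply Rle_trans; [apply HF|apply Hb]. }
  assert (A := H Re _ re_le_Cmod H1). assert (B := H Im _ im_le_Cmod H2).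
  assert (T := Cmod_le_sum l); lra.
Qed.

Definition dcoeffs (a : nat -> C) (n : nat) : C := (RtoC (INR (S n)) * a (S n))%C.

Lemma disk_coeffs_dcoeffs (a : nat -> C) : disk_coeffs a -> disk_coeffs (dcoeffs a).
Proof. intros Ha; apply (disk_coeffs_shift _ (disk_coeffs_INR a Ha)). Qed.

(** Second-order remainder of a monomial. By induction on the degree: the
    remainder [e n] satisfies
    [e (n + 1) = y e n + (n + 1) (y - z)^2 z^n]. The factor [r] on the left
    avoids the exponent [n - 1]. *)
Lemma Cpow_remainder_le (r : R) (y z : C) (n : nat) :
  Cmod y <= r -> Cmod z <= r ->
  r * Cmod (y ^ S n - z ^ S n - RtoC (INR (S n)) * (y - z) * z ^ n)%C
    <= Cmod (y - z)%C ^ 2 * (INR n * INR (S n) * r ^ n).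
Proof.
  intros Hy Hz; assert (HR : 0 <= r) by (eapply Rle_trans; [apply Cmod_ge_0|exact Hy]).
  induction n as [|n IH].
  - replace (y ^ 1 - z ^ 1 - RtoC (INR 1) * (y - z) * z ^ 0)%C with (RtoC 0).
    + rewrite Cmod_0; simpl INR; lra.
    + simpl INR; simpl Cpow; ring.
  - set (e := (y ^ S n - z ^ S n - RtoC (INR (S n)) * (y - z) * z ^ n)%C) in *.
    replace (y ^ S (S n) - z ^ S (S n) - RtoC (INR (S (S n))) * (y - z) * z ^ S n)%C
      with (y * e + RtoC (INR (S n)) * ((y - z) * (y - z)) * z ^ n)%C.
    2:{ unfold e; rewrite (S_INR (S n)), RtoC_plus, !Cpow_S; ring. }
    apply Rle_trans with
      (r * (r * Cmod e) + r * (INR (S n) * Cmod (y - z) ^ 2 * r ^ n)).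
    + rewrite <- Rmult_plus_distr_l; apply Rmult_le_compat_l; [exact HR|].
      eapply Rle_trans; [apply Cmod_triangle|].
      rewrite !Cmod_mult, Cmod_R, Cmod_pow, Rabs_pos_eq by apply pos_INR.
      apply Rplus_le_compat.
      * apply Rmult_le_compat_r; [apply Cmod_ge_0|exact Hy].
      * rewrite <- (Rmult_1_r (Cmod (y - z) )) at 2.
        replace (Cmod (y - z) * (Cmod (y - z) * 1)) with (Cmod (y - z) ^ 2) by reflexivity.
        apply Rmult_le_compat_l.
        -- apply Rmult_le_pos; [apply pos_INR|apply pow2_ge_0].
        -- apply pow_incr; split; [apply Cmod_ge_0|exact Hz].
    + assert (IH' := Rmult_le_compat_l r _ _ HR IH).
      rewrite (S_INR (S n)), (S_INR n) in *. change (r ^ S n) with (r * r ^ n).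
      assert (P : 0 <= Cmod (y - z)%C ^ 2 * (r * r ^ n)).
      { apply Rmult_le_pos; [apply pow2_ge_0|apply Rmult_le_pos; [exact HR|now apply pow_le]]. }
      assert (N := pos_INR n).
      assert (0 <= (INR n + 1) * (Cmod (y - z)%C ^ 2 * (r * r ^ n))) by (apply Rmult_le_pos; lra).
      nra.
Qed.

(** Term-by-term differentiation: the remainders of the monomials sum to
    [O(|y - z|^2)] uniformly for [y] in a disk of radius [r < 1], because the
    twice differentiated series converges absolutely at [r]. *)
Lemma CPSeries_is_cderive (a : nat -> C) (z : C) :
  disk_coeffs a -> in_disk z -> is_cderive (CPSeries a) z (CPSeries (dcoeffs a) z).
Proof.
  intros Ha Hz; set (r := (1 + Cmod z) / 2).
  assert (Hz' : Cmod z < 1) by exact Hz.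
  assert (H0 : 0 <= Cmod z) by apply Cmod_ge_0.
  assert (HR : Cmod z < r < 1) by (unfold r; lra).
  set (b := fun n => (RtoC (INR n) * dcoeffs a n)%C).
  assert (Hb : disk_coeffs b) by (apply disk_coeffs_INR, disk_coeffs_dcoeffs, Ha).
  assert (Sb : ex_series (fun n => Cmod (b n) * r ^ n)) by (apply disk_coeffs_abs; [exact Hb|lra]).
  set (M := Series (fun n => Cmod (b n) * r ^ n)) in *.
  assert (HM : 0 <= M).
  { rewrite <- (Rmult_0_l (Series (fun n => Cmod (b n) * r ^ n))).
    unfold M; rewrite <- Series_scal_l; apply Series_le; [|exact Sb].
    intros n; rewrite Rmult_0_l; split; [lra|].
    apply Rmult_le_pos; [apply Cmod_ge_0|apply pow_le; lra]. }
  assert (K : forall y, Cmod y <= r ->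
    r * Cmod (CPSeries a y - CPSeries a z - (y - z) * CPSeries (dcoeffs a) z)%C <= 2 * M * Cmod (y - z)%C ^ 2).
  { intros y Hy. assert (Hyd : in_disk y) by (unfold in_disk; lra).
    set (e := fun n => (y ^ S n - z ^ S n - RtoC (INR (S n)) * (y - z) * z ^ n)%C).
    assert (Hs : @is_series C_AbsRing C_NormedModule (fun n => RtoC r * (a (S n) * e n))%C
        (RtoC r * (CPSeries a y - CPSeries a z - (y - z) * CPSeries (dcoeffs a) z))%C).
    { apply (@is_series_scal C_AbsRing C_NormedModule).
      rewrite (CPSeries_shift a y), (CPSeries_shift a z) by assumption.
      replace (a 0%nat + y * CPSeries (fun n => a (S n)) y - (a 0%nat + z * CPSeries (fun n => a (S n)) z)
          - (y - z) * CPSeries (dcoeffs a) z)%C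
        with (minus (minus (scal y (CPSeries (fun n => a (S n)) y) : C_NormedModule) (scal z (CPSeries (fun n => a (S n)) z)))
           (scal (y - z)%C (CPSeries (dcoeffs a) z)))
        by (unfold minus, plus, scal, opp; simpl; unfold mult; simpl; ring).
      assert (Hsa := disk_coeffs_shift a Ha). assert (Hda := disk_coeffs_dcoeffs a Ha).
      apply (@is_series_ext C_AbsRing C_NormedModule) with
        (fun n => minus (minus (scal y (a (S n) * y ^ n)%C) (scal z (a (S n) * z ^ n)%C))
                 (scal (y - z)%C (dcoeffs a n * z ^ n)%C)).
      { intros n; unfold e, dcoeffs, minus, plus, scal, opp; simpl; unfold mult; simpl; ring. }
      apply (@is_series_minus C_AbsRing C_NormedModule);
        [apply (@is_series_minus C_AbsRing C_NormedModule)|];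
        apply (@is_series_scal C_AbsRing C_NormedModule);
        apply CPSeries_is_series; assumption. }
    assert (HC := Cmod_is_series_le _ (fun n => Cmod (y - z)%C ^ 2 * (Cmod (b n) * r ^ n)) _ Hs).
    rewrite Cmod_mult, Cmod_R, Rabs_pos_eq, Series_scal_l in HC by lra.
    fold M in HC; rewrite Rmult_assoc, (Rmult_comm M).
    apply HC.
    - intros n; rewrite !Cmod_mult, Cmod_R, Rabs_pos_eq by lra.
      assert (P := Cpow_remainder_le r y z n Hy (Rlt_le _ _ (proj1 HR))). fold (e n) in P.
      unfold b, dcoeffs; rewrite !Cmod_mult, !Cmod_R, !Rabs_pos_eq by apply pos_INR.
      apply (Rmult_le_compat_l (Cmod (a (S n)))) in P; [|apply Cmod_ge_0]. lra.
    - apply (@ex_series_scal R_AbsRing R_NormedModule), Sb. }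
  apply is_cderive_eps; intros eps Heps.
  exists (Rmin (r - Cmod z) (eps * r / (2 * M + 1))); split.
  { apply Rmin_pos; [lra|apply Rdiv_lt_0_compat; nra]. }
  intros y Hy.
  assert (D1 := Rlt_le_trans _ _ _ Hy (Rmin_l _ _)).
  assert (D2 := Rlt_le_trans _ _ _ Hy (Rmin_r _ _)).
  assert (T := Cmod_triangle (y - z) z).
  replace (y - z + z)%C with y in T by ring.
  specialize (K y ltac:(lra)).
  apply Rmult_le_reg_l with r; [lra|].
  eapply Rle_trans; [exact K|].
  set (d := Cmod (y - z)%C) in *. assert (Hd : 0 <= d) by apply Cmod_ge_0.
  apply Rlt_div_r in D2; [|lra].
  replace (2 * M * d ^ 2) with ((2 * M * d) * d) by ring.
  replace (r * (eps * d)) with ((eps * r) * d) by ring.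
  apply Rmult_le_compat_r; [exact Hd|]. lra.
Qed.

Lemma CPSeries_continuous (a : nat -> C) (z : C) :
  disk_coeffs a -> in_disk z -> @continuous C_UniformSpace C_UniformSpace (CPSeries a) z.
Proof. intros Ha Hz; eapply is_cderive_continuous, CPSeries_is_cderive; assumption. Qed.

Lemma continuous_vanish_at_0 (D : C -> C) :
  @continuous C_UniformSpace C_UniformSpace D (RtoC 0) ->
  (forall z, in_disk z -> z <> RtoC 0 -> D z = RtoC 0) -> D (RtoC 0) = RtoC 0.
Proof.
  intros HD Hnz; destruct (Ceq_dec (D (RtoC 0)) (RtoC 0)) as [E|E]; [exact E|exfalso].
  apply Cmod_gt_0 in E.
  destruct (proj1 (continuous_C_eps _ _) HD _ E) as [d [Hd Hc]].
  set (w := RtoC (Rmin (1 / 2) (d / 2))).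
  assert (Hw : 0 < Rmin (1 / 2) (d / 2)) by (apply Rmin_pos; lra).
  assert (Hw1 := Rmin_l (1 / 2) (d / 2)). assert (Hw2 := Rmin_r (1 / 2) (d / 2)).
  assert (Mw : Cmod w = Rmin (1 / 2) (d / 2)) by (unfold w; rewrite Cmod_R, Rabs_pos_eq; lra).
  specialize (Hc w); rewrite (Hnz w) in Hc.
  - replace (0 - D 0)%C with (- D 0)%C in Hc by ring.
    replace (w - 0)%C with w in Hc by ring.
    rewrite Cmod_opp in Hc; lra.
  - unfold in_disk; lra.
  - apply Cmod_gt_0; lra.
Qed.

Lemma Cmult_eq_reg_l (z u v : C) : z <> RtoC 0 -> (z * u = z * v)%C -> u = v.
Proof.
  intros Hz E; apply (f_equal (fun w => / z * w)%C) in E.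
  now rewrite !Cmult_assoc, Cinv_l, !Cmult_1_l in E.
Qed.

(** Dividing an identity by [z] loses the origin; continuity restores it. *)
Lemma cancel_z_continuous (F G : C -> C) :
  @continuous C_UniformSpace C_UniformSpace F (RtoC 0) ->
  @continuous C_UniformSpace C_UniformSpace G (RtoC 0) ->
  (forall z, in_disk z -> (z * F z = z * G z)%C) ->
  forall z, in_disk z -> F z = G z.
Proof.
  intros HF HG H z Hz; destruct (Ceq_dec z (RtoC 0)) as [->|Hz0].
  - apply Ceq_minus, (continuous_vanish_at_0 (fun z => F z - G z)%C).
    + apply (@continuous_minus C_UniformSpace C_AbsRing C_NormedModule); assumption.
    + intros w Hw Hw0; apply -> Ceq_minus; apply (Cmult_eq_reg_l w); auto.
  - apply (Cmult_eq_reg_l z); auto.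
Qed.

Lemma CPSeries_zero_coeffs (a : nat -> C) :
  disk_coeffs a -> (forall z, in_disk z -> CPSeries a z = RtoC 0) -> forall n, a n = RtoC 0.
Proof.
  intros Ha H n; revert a Ha H; induction n as [|n IH]; intros a Ha H.
  - rewrite <- (CPSeries_0 a Ha); apply H, in_disk_0.
  - assert (Hsa := disk_coeffs_shift a Ha).
    apply (IH (fun k => a (S k)) Hsa).
    apply (cancel_z_continuous (CPSeries (fun k => a (S k))) (fun _ => RtoC 0)).
    + apply CPSeries_continuous; [exact Hsa|apply in_disk_0].
    + apply continuous_const.
    + intros z Hz; transitivity (CPSeries a z - a 0%nat)%C.
      * rewrite (CPSeries_shift a z Ha Hz); ring.
      * rewrite <- (CPSeries_0 a Ha), !H by auto using in_disk_0; ring.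
Qed.

Lemma CPSeries_inj (a b : nat -> C) :
  disk_coeffs a -> disk_coeffs b -> (forall z, in_disk z -> CPSeries a z = CPSeries b z) ->
  forall n, a n = b n.
Proof.
  intros Ha Hb H n.
  apply Ceq_minus.
  replace (a n - b n)%C with (a n + (- RtoC 1) * b n)%C by ring.
  apply (CPSeries_zero_coeffs (fun k => a k + (- RtoC 1) * b k)%C).
  - now apply disk_coeffs_plus; [|apply disk_coeffs_scal].
  - intros z Hz; rewrite CPSeries_plus, CPSeries_scal, H by (auto using disk_coeffs_scal).
    ring.
Qed.

Fixpoint csum (u : nat -> C) (n : nat) : C :=
  match n with
  | O => RtoC 0
  | S m => (u 0%nat + csum (fun k => u (S k)) m)%C
  end.

(** Coefficients of a product. Peeling off the constant term of the first
    factor turns the identity for [a] into the same identity for the shifted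
    sequence, so no rearrangement of double series is needed. *)
Lemma CPSeries_mult_coeffs (b : nat -> C) (n : nat) :
  disk_coeffs b ->
  forall a c, disk_coeffs a -> disk_coeffs c ->
  (forall z, in_disk z -> (CPSeries a z * CPSeries b z)%C = CPSeries c z) ->
  c n = csum (fun k => a k * b (n - k)%nat)%C (S n).
Proof.
  intros Hb; induction n as [|n IH]; intros a c Ha Hc H.
  - simpl; rewrite <- (CPSeries_0 c Hc), <- (H _ in_disk_0), !CPSeries_0 by assumption; ring.
  - assert (Hsa := disk_coeffs_shift a Ha). assert (Hsb := disk_coeffs_shift b Hb).
    assert (Hsc := disk_coeffs_shift c Hc).
    assert (C0 : c 0%nat = (a 0%nat * b 0%nat)%C)
      by (rewrite <- (CPSeries_0 c Hc), <- (H _ in_disk_0), !CPSeries_0 by assumption; ring).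
    set (c' := fun k => (c (S k) + (- a 0%nat) * b (S k))%C).
    assert (Hc' : disk_coeffs c')
      by (apply disk_coeffs_plus; [exact Hsc|now apply disk_coeffs_scal]).
    assert (E : forall z, in_disk z -> (CPSeries (fun k => a (S k)) z * CPSeries b z)%C = CPSeries c' z).
    { apply cancel_z_continuous.
      - eapply is_cderive_continuous, is_cderive_mult; apply CPSeries_is_cderive;
          auto using in_disk_0.
      - apply CPSeries_continuous; auto using in_disk_0.
      - intros z Hz; unfold c'.
        rewrite CPSeries_plus, CPSeries_scal by auto using disk_coeffs_scal.
        transitivity (CPSeries c z - c 0%nat - a 0%nat * (CPSeries b z - b 0%nat))%C.
        + rewrite <- (H z Hz), C0, (CPSeries_shift a z Ha Hz); ring.
        + rewrite (CPSeries_shift c z Hc Hz), (CPSeries_shift b z Hb Hz); ring. }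
    assert (F := IH _ _ Hsa Hc' E).
    unfold c' in F.
    change (csum (fun k => a k * b (S n - k)%nat)%C (S (S n)))
      with (a 0%nat * b (S n) + csum (fun k => a (S k) * b (n - k)%nat)%C (S n))%C.
    rewrite <- F; ring.
Qed.

(** * The exponential *)

Lemma Cexp_plus (a b : C) : Cexp (a + b)%C = (Cexp a * Cexp b)%C.
Proof.
  destruct a as [x y], b as [u v]; unfold Cexp, Cmult, Cplus, Re, Im; simpl.
  rewrite exp_plus, cos_plus, sin_plus; f_equal; ring.
Qed.

Lemma Cexp_0 : Cexp (RtoC 0) = RtoC 1.
Proof. unfold Cexp, RtoC, Re, Im; simpl; rewrite exp_0, cos_0, sin_0; f_equal; ring. Qed.

Lemma Cexp_opp_l (z : C) : (Cexp (- z) * Cexp z)%C = RtoC 1.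
Proof. rewrite <- Cexp_plus, <- Cexp_0; f_equal; ring. Qed.

Lemma Cexp_neq_0 (z : C) : Cexp z <> RtoC 0.
Proof.
  intros E; apply C1_nz; rewrite <- (Cexp_opp_l z), E; ring.
Qed.

Lemma Cmod_Cexp (z : C) : Cmod (Cexp z) = exp (Re z).
Proof.
  unfold Cmod, Cexp; simpl fst; simpl snd.
  replace ((exp (Re z) * cos (Im z)) ^ 2 + (exp (Re z) * sin (Im z)) ^ 2) with (exp (Re z) ^ 2).
  - rewrite <- Rsqr_pow2; apply sqrt_Rsqr, Rlt_le, exp_pos.
  - assert (E := sin2_cos2 (Im z)); unfold Rsqr in E.
    transitivity (exp (Re z) ^ 2 * (sin (Im z) * sin (Im z) + cos (Im z) * cos (Im z)));
      [rewrite E|]; ring.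
Qed.

Lemma is_derive_eps (f : R -> R) (x l : R) :
  is_derive f x l <->
  forall eps, 0 < eps -> exists delta, 0 < delta /\
    forall y, Rabs (y - x) < delta ->
      Rabs (f y - f x - (y - x) * l) <= eps * Rabs (y - x).
Proof.
  split.
  - intros [_ H] eps Heps.
    destruct (H x (fun P HP => HP) (mkposreal eps Heps)) as [d Hd].
    exists d; split; [apply cond_pos|].
    intros y Hy; apply Hd, Hy.
  - intros H; split; [apply is_linear_scal_l|].
    intros y Hy.
    assert (E : x = y) by exact (@is_filter_lim_locally_unique R_AbsRing (AbsRing_NormedModule R_AbsRing) x y Hy).
    subst y; intros eps.
    destruct (H eps (cond_pos eps)) as [d [Hd Hk]].
    exists (mkposreal d Hd); intros y Hyz; apply Hk, Hyz.
Qed.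

(** By the addition theorem it suffices to differentiate at 0, where the real
    derivatives of [exp], [cos] and [sin] control both components. *)
Lemma is_cderive_Cexp (z : C) : is_cderive Cexp z (Cexp z).
Proof.
  apply is_cderive_eps; intros eps Heps.
  set (e := Rmin 1 (eps / (12 * exp (Re z)))).
  assert (Hez := exp_pos (Re z)).
  assert (He : 0 < e) by (apply Rmin_pos; [lra|apply Rdiv_lt_0_compat; lra]).
  assert (He1 : e <= 1) by apply Rmin_l.
  assert (He2 : e <= eps / (12 * exp (Re z))) by apply Rmin_r.
  clearbody e.
  assert (Dexp : is_derive exp 0 1) by (assert (H := is_derive_exp 0); rewrite exp_0 in H; exact H).
  assert (Dcos : is_derive cos 0 0) by (assert (H := is_derive_cos 0); rewrite sin_0, Ropp_0 in H; exact H).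
  assert (Dsin : is_derive sin 0 1) by (assert (H := is_derive_sin 0); rewrite cos_0 in H; exact H).
  destruct (proj1 (is_derive_eps _ _ _) Dexp e He) as [d1 [Hd1 H1]].
  destruct (proj1 (is_derive_eps _ _ _) Dcos e He) as [d2 [Hd2 H2]].
  destruct (proj1 (is_derive_eps _ _ _) Dsin e He) as [d3 [Hd3 H3]].
  exists (Rmin e (Rmin d1 (Rmin d2 d3))); split; [repeat apply Rmin_pos; assumption|].
  intros y Hy.
  assert (L0 := Rlt_le_trans _ _ _ Hy (Rmin_l _ _)).
  assert (L := Rlt_le_trans _ _ _ Hy (Rmin_r _ _)).
  assert (L1 := Rlt_le_trans _ _ _ L (Rmin_l _ _)).
  assert (L' := Rlt_le_trans _ _ _ L (Rmin_r _ _)).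
  assert (L2 := Rlt_le_trans _ _ _ L' (Rmin_l _ _)).
  assert (L3 := Rlt_le_trans _ _ _ L' (Rmin_r _ _)).
  set (h := (y - z)%C) in *.
  replace (Cexp y) with (Cexp z * Cexp h)%C by (rewrite <- Cexp_plus; f_equal; unfold h; ring).
  replace (Cexp z * Cexp h - Cexp z - h * Cexp z)%C with (Cexp z * (Cexp h - 1 - h))%C by ring.
  rewrite Cmod_mult, Cmod_Cexp.
  assert (Hx := re_le_Cmod h). assert (Hy' := im_le_Cmod h).
  assert (Hh := Cmod_ge_0 h).
  specialize (H1 (Re h)). specialize (H2 (Im h)). specialize (H3 (Im h)).
  rewrite Rminus_0_r in H1, H2, H3.
  rewrite exp_0 in H1; rewrite cos_0 in H2; rewrite sin_0 in H3.
  specialize (H1 ltac:(lra)). specialize (H2 ltac:(lra)). specialize (H3 ltac:(lra)).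
  set (x := Re h) in *. set (v := Im h) in *. set (m := Cmod h) in *.
  assert (B1 : Rabs (exp x - 1 - x * 1) <= e * m) by nra.
  assert (B2 : Rabs (cos v - 1 - v * 0) <= e * m) by nra.
  assert (B3 : Rabs (sin v - 0 - v * 1) <= e * m) by nra.
  assert (B4 : Rabs (exp x - 1) <= 2 * m).
  { replace (exp x - 1) with ((exp x - 1 - x * 1) + x) by ring.
    eapply Rle_trans; [apply Rabs_triang|nra]. }
  assert (Bc : Rabs (cos v) <= 1) by (apply Rabs_le, COS_bound).
  assert (Bs : Rabs (sin v) <= 1) by (apply Rabs_le, SIN_bound).
  assert (B5 : Rabs (sin v) <= 2 * m).
  { replace (sin v) with ((sin v - 0 - v * 1) + v) by ring.
    eapply Rle_trans; [apply Rabs_triang|nra]. }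
  assert (R1 : Rabs (Re (Cexp h - 1 - h)%C) <= 3 * e * m).
  { replace (Re (Cexp h - 1 - h)%C)
      with ((exp x - 1 - x * 1) * cos v + (1 + x) * (cos v - 1 - v * 0)).
    2:{ unfold x, v, Cexp, Cminus, Cplus, Copp, Re, Im, RtoC; simpl; ring. }
    eapply Rle_trans; [apply Rabs_triang|]. rewrite !Rabs_mult.
    assert (Rabs (1 + x) <= 2).
    { eapply Rle_trans; [apply Rabs_triang|]. rewrite Rabs_R1; lra. }
    assert (A := Rabs_pos (exp x - 1 - x * 1)). assert (A' := Rabs_pos (cos v - 1 - v * 0)).
    assert (A'' := Rabs_pos (cos v)). assert (A3 := Rabs_pos (1 + x)). nra. }
  assert (R2 : Rabs (Im (Cexp h - 1 - h)%C) <= 5 * e * m).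
  { replace (Im (Cexp h - 1 - h)%C)
      with ((exp x - 1) * sin v + (sin v - 0 - v * 1)).
    2:{ unfold x, v, Cexp, Cminus, Cplus, Copp, Re, Im, RtoC; simpl; ring. }
    eapply Rle_trans; [apply Rabs_triang|]. rewrite !Rabs_mult.
    assert (A := Rabs_pos (exp x - 1)). assert (A' := Rabs_pos (sin v)). nra. }
  assert (T := Cmod_le_sum (Cexp h - 1 - h)%C).
  apply Rle_trans with (exp (Re z) * (8 * e * m)); [apply Rmult_le_compat_l; lra|].
  apply Rle_div_r in He2; [|lra]. nra.
Qed.

(** * Means over circles *)

Notation ccontinuous := (@continuous C_UniformSpace C_UniformSpace) (only parsing).

Definition path_continuous (h : R -> C) : Prop :=
  forall t, @continuous R_UniformSpace C_UniformSpace h t.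

Definition cmean (h : R -> C) : C :=
  (/ (2 * PI) * RInt (fun t => Re (h t)) 0 (2 * PI),
   / (2 * PI) * RInt (fun t => Im (h t)) 0 (2 * PI)).

Definition circle (s t : R) : C := (RtoC s * Cexp (RtoC t * Ci))%C.

Lemma continuous_Cmult (T : UniformSpace) (f g : T -> C) (x : T) :
  @continuous T C_UniformSpace f x -> @continuous T C_UniformSpace g x ->
  @continuous T C_UniformSpace (fun y => f y * g y)%C x.
Proof.
  intros Hf Hg P HP; apply locally_C in HP.
  apply (@continuous_mult T C_AbsRing f g x); [| |exact HP].
  - intros Q HQ; apply Hf, locally_C, HQ.
  - intros Q HQ; apply Hg, locally_C, HQ.
Qed.

Lemma continuous_Cplus (T : UniformSpace) (f g : T -> C) (x : T) :
  @continuous T C_UniformSpace f x -> @continuous T C_UniformSpace g x ->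
  @continuous T C_UniformSpace (fun y => f y + g y)%C x.
Proof. apply (@continuous_plus T C_AbsRing C_NormedModule). Qed.

Lemma continuous_Cminus (T : UniformSpace) (f g : T -> C) (x : T) :
  @continuous T C_UniformSpace f x -> @continuous T C_UniformSpace g x ->
  @continuous T C_UniformSpace (fun y => f y - g y)%C x.
Proof. apply (@continuous_minus T C_AbsRing C_NormedModule). Qed.

Lemma continuous_Re (T : UniformSpace) (f : T -> C) (x : T) :
  @continuous T C_UniformSpace f x -> continuous (fun y => Re (f y)) x.
Proof. intros H; apply (@continuous_comp T C_UniformSpace R_UniformSpace f Re x H), continuous_fst. Qed.

Lemma continuous_Im (T : UniformSpace) (f : T -> C) (x : T) :
  @continuous T C_UniformSpace f x -> continuous (fun y => Im (f y)) x.
Proof. intros H; apply (@continuous_comp T C_UniformSpace R_UniformSpace f Im x H), continuous_snd. Qed.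

Lemma continuous_pair (T : UniformSpace) (f g : T -> R) (x : T) :
  continuous f x -> continuous g x ->
  @continuous T C_UniformSpace (fun y => (f y, g y)) x.
Proof.
  intros Hf Hg P [e He].
  specialize (Hf _ (locally_ball (f x) e)). specialize (Hg _ (locally_ball (g x) e)).
  unfold filtermap in *; generalize (filter_and _ _ Hf Hg); apply filter_imp.
  intros y [A B]; apply He; split; assumption.
Qed.

Lemma continuous_RtoC (T : UniformSpace) (f : T -> R) (x : T) :
  continuous f x -> @continuous T C_UniformSpace (fun y => RtoC (f y)) x.
Proof. intros H; apply continuous_pair; [exact H|apply continuous_const]. Qed.

Lemma continuous_Cmod (T : UniformSpace) (f : T -> C) (x : T) :
  @continuous T C_UniformSpace f x -> continuous (fun y => Cmod (f y)) x.
Proof.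
  intros H; apply (continuous_comp f Cmod x H).
  apply (@filterlim_norm C_AbsRing C_NormedModule).
Qed.

Lemma continuous_Cexp (z : C) : ccontinuous Cexp z.
Proof. eapply is_cderive_continuous, is_cderive_Cexp. Qed.

Lemma circle_neq_0 (s t : R) : 0 < s -> circle s t <> RtoC 0.
Proof.
  intros Hs; apply Cmult_neq_0; [|apply Cexp_neq_0].
  intros E; apply RtoC_inj in E; lra.
Qed.

Lemma Cmod_circle (s t : R) : 0 <= s -> Cmod (circle s t) = s.
Proof.
  intros Hs; unfold circle; rewrite Cmod_mult, Cmod_R, Cmod_Cexp, Rabs_pos_eq by exact Hs.
  replace (Re (RtoC t * Ci)%C) with 0 by (unfold Re, RtoC, Ci, Cmult; simpl; ring).
  rewrite exp_0; ring.
Qed.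

Lemma circle_periodic (s : R) : circle s (2 * PI) = circle s 0.
Proof.
  unfold circle, Cexp, RtoC, Ci, Cmult, Re, Im; simpl.
  replace (2 * PI * 0 - 0 * 1) with (0 * 0 - 0 * 1) by ring.
  replace (2 * PI * 1 + 0 * 0) with (2 * PI) by ring.
  replace (0 * 1 + 0 * 0) with 0 by ring.
  now rewrite cos_2PI, sin_2PI, cos_0, sin_0.
Qed.

Lemma path_continuous_circle (s : R) : path_continuous (circle s).
Proof.
  intros t; apply continuous_Cmult; [apply continuous_const|].
  apply (continuous_comp (fun u : R => (RtoC u * Ci)%C) Cexp); [|apply continuous_Cexp].
  apply continuous_Cmult; [|apply continuous_const].
  apply continuous_RtoC, continuous_id.
Qed.

Lemma ex_RInt_continuous_all (u : R -> R) (a b : R) :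
  (forall t, continuous u t) -> ex_RInt u a b.
Proof. intros H; apply (@ex_RInt_continuous R_CompleteNormedModule); intros; apply H. Qed.

Lemma cmean_plus (h k : R -> C) :
  path_continuous h -> path_continuous k ->
  cmean (fun t => h t + k t)%C = (cmean h + cmean k)%C.
Proof.
  intros Hh Hk; unfold cmean, Cplus; simpl.
  rewrite <- !Rmult_plus_distr_l.
  assert (Cx := fun t => continuous_Re _ _ t (Hh t)). assert (Cy := fun t => continuous_Re _ _ t (Hk t)).
  assert (Dx := fun t => continuous_Im _ _ t (Hh t)). assert (Dy := fun t => continuous_Im _ _ t (Hk t)).
  f_equal; f_equal;
    rewrite <- (@RInt_plus R_CompleteNormedModule) by (apply ex_RInt_continuous_all; assumption);
    reflexivity.
Qed.

Lemma cmean_scal (k : C) (h : R -> C) :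
  path_continuous h -> cmean (fun t => k * h t)%C = (k * cmean h)%C.
Proof.
  intros Hh.
  assert (Cx := fun t => continuous_Re _ _ t (Hh t)).
  assert (Dx := fun t => continuous_Im _ _ t (Hh t)).
  destruct k as [a b]; unfold cmean, Cmult; simpl; f_equal.
  - transitivity (/ (2 * PI) * (a * RInt (fun t => Re (h t)) 0 (2 * PI)
        - b * RInt (fun t => Im (h t)) 0 (2 * PI))); [|ring].
    f_equal; rewrite <- !(@RInt_scal R_CompleteNormedModule) by (apply ex_RInt_continuous_all; assumption).
    rewrite <- (@RInt_minus R_CompleteNormedModule); [reflexivity| |];
      apply (@ex_RInt_scal R_NormedModule), ex_RInt_continuous_all; assumption.
  - transitivity (/ (2 * PI) * (a * RInt (fun t => Im (h t)) 0 (2 * PI)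
        + b * RInt (fun t => Re (h t)) 0 (2 * PI))); [|ring].
    f_equal; rewrite <- !(@RInt_scal R_CompleteNormedModule) by (apply ex_RInt_continuous_all; assumption).
    rewrite <- (@RInt_plus R_CompleteNormedModule); [reflexivity| |];
      apply (@ex_RInt_scal R_NormedModule), ex_RInt_continuous_all; assumption.
Qed.

Lemma cmean_ext (h k : R -> C) : (forall t, h t = k t) -> cmean h = cmean k.
Proof.
  intros H; unfold cmean; f_equal; f_equal;
    apply RInt_ext; intros t _; now rewrite H.
Qed.

Lemma cmean_const (k : C) : cmean (fun _ => k) = k.
Proof.
  destruct k as [a b]; unfold cmean; simpl; rewrite !RInt_const.
  unfold scal; simpl; unfold mult; simpl.
  assert (P := PI_RGT_0); f_equal; field; lra.
Qed.

Lemma Re_cmean_le (h k : R -> C) :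
  path_continuous h -> path_continuous k -> (forall t, Re (h t) <= Re (k t)) ->
  Re (cmean h) <= Re (cmean k).
Proof.
  intros Hh Hk H; assert (P := PI_RGT_0); simpl.
  apply Rmult_le_compat_l; [left; apply Rinv_0_lt_compat; lra|].
  apply RInt_le; [lra| | |intros t _; apply H];
    apply ex_RInt_continuous_all; intros t; now apply continuous_Re.
Qed.

Lemma cmean_conj (h : R -> C) :
  path_continuous h -> cmean (fun t => Cconj (h t)) = Cconj (cmean h).
Proof.
  intros Hh; unfold cmean, Cconj; simpl; f_equal.
  rewrite Ropp_mult_distr_r; f_equal.
  rewrite <- (@RInt_opp R_CompleteNormedModule); [reflexivity|].
  apply ex_RInt_continuous_all; intros t; now apply continuous_Im.
Qed.

(** Rotating the mean onto the positive axis reduces the triangle inequality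
    for integrals to monotonicity of the real part. *)
Lemma Cmod_cmean_le (h : R -> C) (u : R -> R) :
  path_continuous h -> (forall t, continuous u t) -> (forall t, Cmod (h t) <= u t) ->
  Cmod (cmean h) <= Re (cmean (fun t => RtoC (u t))).
Proof.
  intros Hh Hu H; set (m := cmean h).
  assert (Hu' : path_continuous (fun t => RtoC (u t))) by (intros t; now apply continuous_RtoC).
  assert (E : (Cmod m) ^ 2 <= Cmod m * Re (cmean (fun t => RtoC (u t)))).
  { replace (Cmod m ^ 2) with (Re (cmean (fun t => Cconj m * h t)%C)).
    - rewrite <- re_scal_l, <- cmean_scal by exact Hu'.
      apply Re_cmean_le.
      + intros t; apply continuous_Cmult; [apply continuous_const|apply Hh].
      + intros t; apply continuous_Cmult; [apply continuous_const|apply Hu'].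
      + intros t; eapply Rle_trans; [apply Rle_abs|].
        eapply Rle_trans; [apply re_le_Cmod|].
        rewrite Cmod_mult, Cmod_conj, re_scal_l, re_RtoC.
        apply Rmult_le_compat_l; [apply Cmod_ge_0|apply H].
    - rewrite cmean_scal by exact Hh; fold m.
      rewrite Cmult_comm, <- re_RtoC; f_equal; rewrite RtoC_pow; symmetry.
      rewrite <- RtoC_pow; apply Cmod2_conj. }
  destruct (Req_dec (Cmod m) 0) as [Z|Z].
  - rewrite Z.
    rewrite <- (re_RtoC 0), <- (cmean_const (RtoC 0)); apply Re_cmean_le; [|exact Hu'|].
    + intros t; apply continuous_const.
    + intros t; rewrite !re_RtoC; eapply Rle_trans; [apply Cmod_ge_0|apply H].
  - assert (P := Cmod_ge_0 m). apply Rmult_le_reg_l with (Cmod m); lra.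
Qed.

(** * Cauchy's theorem *)

(** Continuity of the derivative is part of the definition, since Cauchy's
    theorem is obtained by differentiation under the integral sign. *)
Definition holo (g : C -> C) : Prop :=
  exists dg : C -> C, forall z, in_disk z ->
    is_cderive g z (dg z) /\ ccontinuous dg z.

Lemma is_derive_Re_line (g : C -> C) (w d l : C) (t : R) :
  is_cderive g (w + RtoC t * d)%C l ->
  is_derive (fun u : R => Re (g (w + RtoC u * d)%C)) t (Re (d * l)%C).
Proof.
  intros H; apply is_derive_eps; intros eps Heps.
  assert (Hd := Cmod_ge_0 d).
  destruct (proj1 (is_cderive_eps _ _ _) H (eps / (Cmod d + 1))) as [e [He Hg]].
  { apply Rdiv_lt_0_compat; lra. }
  exists (e / (Cmod d + 1)); split; [apply Rdiv_lt_0_compat; lra|].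
  intros u Hu; apply Rlt_div_r in Hu; [|lra].
  assert (P := Rabs_pos (u - t)).
  specialize (Hg (w + RtoC u * d)%C).
  replace (w + RtoC u * d - (w + RtoC t * d))%C with (RtoC (u - t) * d)%C in Hg
    by (rewrite RtoC_minus; ring).
  rewrite Cmod_mult, Cmod_R in Hg. specialize (Hg ltac:(nra)).
  eapply Rle_trans; [|eapply Rle_trans; [exact Hg|]].
  - eapply Rle_trans; [|apply re_le_Cmod]; right; f_equal.
    unfold Cminus; rewrite !re_plus, !re_opp, <- Cmult_assoc, re_scal_l; ring.
  - replace (eps / (Cmod d + 1) * (Rabs (u - t) * Cmod d))
      with (eps * Rabs (u - t) * (Cmod d / (Cmod d + 1))) by (field; lra).
    rewrite <- (Rmult_1_r (eps * Rabs (u - t))) at 2.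
    apply Rmult_le_compat_l; [apply Rmult_le_pos; lra|].
    apply Rle_div_l; lra.
Qed.

Lemma holo_continuous (g : C -> C) (z : C) : holo g -> in_disk z -> ccontinuous g z.
Proof. intros [dg H] Hz; eapply is_cderive_continuous, H, Hz. Qed.

Lemma holo_scal (k : C) (g : C -> C) : holo g -> holo (fun z => k * g z)%C.
Proof.
  intros [dg H]; exists (fun z => k * dg z)%C; intros z Hz; destruct (H z Hz) as [D Cz]; split.
  - eapply is_cderive_eq; [apply is_cderive_mult; [apply is_cderive_const|exact D]|cbv beta; ring].
  - apply continuous_Cmult; [apply continuous_const|exact Cz].
Qed.

Lemma continuous_continuity_2d (F : R * R -> R) (x y : R) :
  @continuous (prod_UniformSpace R_UniformSpace R_UniformSpace) R_UniformSpace F (x, y) ->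
  continuity_2d_pt (fun u v => F (u, v)) x y.
Proof.
  intros H; apply continuity_2d_pt_filterlim.
  apply filterlim_ext with F; [intros [u v]; reflexivity|exact H].
Qed.

(** Along a circle the derivative has mean zero against [dz]: it is the
    derivative of a periodic function of the angle. *)
Lemma RInt_holo_derivative_circle (g dg : C -> C) (z : C) (s u : R) :
  u <> 0 ->
  (forall t, is_cderive g (z + RtoC u * (circle s t - z))%C
                (dg (z + RtoC u * (circle s t - z))%C)) ->
  (forall t, ccontinuous dg (z + RtoC u * (circle s t - z))%C) ->
  RInt (fun t => Re (circle s t * dg (z + RtoC u * (circle s t - z)))%C) 0 (2 * PI) = 0.
Proof.
  intros Hu Hd Hc.
  set (G := fun w => (- Ci * g (z + RtoC u * (RtoC s * Cexp w - z)))%C).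
  set (h := fun t => Re (circle s t * dg (z + RtoC u * (circle s t - z)))%C).
  assert (D : forall t, is_derive (fun t : R => Re (G (RtoC 0 + RtoC t * Ci)%C)) t (u * h t)).
  { intros t; replace (u * h t) with (Re (Ci * (- Ci * (RtoC u * circle s t * dg (z + RtoC u * (circle s t - z)))))%C).
    - apply is_derive_Re_line; unfold G.
      rewrite Cplus_0_l.
      eapply is_cderive_eq.
      + apply is_cderive_mult; [apply is_cderive_const|].
        apply (is_cderive_comp g (fun w => z + RtoC u * (RtoC s * Cexp w - z))%C); [apply Hd|].
        apply is_cderive_plus; [apply is_cderive_const|].
        apply is_cderive_mult; [apply is_cderive_const|].
        apply is_cderive_minus; [|apply is_cderive_const].
        apply is_cderive_mult; [apply is_cderive_const|apply is_cderive_Cexp].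
      + unfold circle; ring.
    - unfold h; rewrite <- re_scal_l; f_equal.
      assert (E : (Ci * - Ci)%C = RtoC 1) by (unfold Ci, Cmult, Copp, RtoC; simpl; f_equal; ring).
      transitivity ((Ci * - Ci) * (RtoC u * circle s t * dg (z + RtoC u * (circle s t - z))))%C;
        [|rewrite E]; ring. }
  assert (Ch : forall t, continuous h t).
  { intros t; apply continuous_Re, continuous_Cmult; [apply path_continuous_circle|].
    apply (continuous_comp (fun t => z + RtoC u * (circle s t - z))%C dg); [|apply Hc].
    apply continuous_Cplus; [apply continuous_const|].
    apply continuous_Cmult; [apply continuous_const|].
    apply continuous_Cminus; [apply path_continuous_circle|apply continuous_const]. }
  assert (I : is_RInt (fun t => u * h t) 0 (2 * PI)
       (minus (Re (G (RtoC 0 + RtoC (2 * PI) * Ci)%C)) (Re (G (RtoC 0 + RtoC 0 * Ci)%C)))).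
  { apply (@is_RInt_derive R_CompleteNormedModule (fun t : R => Re (G (RtoC 0 + RtoC t * Ci)%C))).
    - intros t _; apply D.
    - intros t _; apply (@continuous_scal_r R_UniformSpace R_AbsRing R_NormedModule), Ch. }
  apply (@is_RInt_unique R_CompleteNormedModule) in I.
  assert (E : RInt (fun t => u * h t) 0 (2 * PI) = u * RInt h 0 (2 * PI)).
  { apply (@RInt_scal R_CompleteNormedModule), ex_RInt_continuous_all, Ch. }
  rewrite E in I.
  assert (Z : minus (Re (G (RtoC 0 + RtoC (2 * PI) * Ci)%C)) (Re (G (RtoC 0 + RtoC 0 * Ci)%C)) = 0).
  { assert (P := circle_periodic s); unfold circle in P.
    unfold G; rewrite !Cplus_0_l, P. apply (@minus_eq_zero R_AbelianGroup). }
  rewrite Z in I; apply Rmult_integral in I; destruct I; [contradiction|assumption].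
Qed.

(** The segment is prolonged slightly at both ends, so that the derivative in
    [u] makes sense on a neighbourhood of [0, 1]. *)
Lemma segment_in_disk (z w : C) (s u : R) :
  Cmod z <= s -> Cmod w <= s -> 0 <= s < 1 ->
  - ((1 - s) / 4) <= u <= 1 + (1 - s) / 4 -> in_disk (z + RtoC u * (w - z))%C.
Proof.
  intros Hz Hw Hs Hu; unfold in_disk.
  replace (z + RtoC u * (w - z))%C with (RtoC (1 - u) * z + RtoC u * w)%C
    by (rewrite RtoC_minus; ring).
  eapply Rle_lt_trans; [apply Cmod_triangle|].
  rewrite !Cmod_mult, !Cmod_R.
  assert (A : Rabs (1 - u) + Rabs u <= 1 + (1 - s) / 2)
    by (unfold Rabs; destruct (Rcase_abs (1 - u)), (Rcase_abs u); lra).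
  assert (P := Rabs_pos (1 - u)). assert (Q := Rabs_pos u).
  apply Rle_lt_trans with (Rabs (1 - u) * s + Rabs u * s).
  - apply Rplus_le_compat; apply Rmult_le_compat_l; assumption.
  - apply Rle_lt_trans with (s * (1 + (1 - s) / 2)); nra.
Qed.

(** Contracting the circle to the point [z] does not change the integral: its
    derivative in the contraction parameter is the integral treated by
    [RInt_holo_derivative_circle]. *)
Lemma RInt_Cauchy_kernel (g : C -> C) (z : C) (s : R) :
  holo g -> Cmod z < s < 1 ->
  RInt (fun t => Re (g (circle s t) * (circle s t / (circle s t - z)))%C) 0 (2 * PI) =
  RInt (fun t => Re (g z * (circle s t / (circle s t - z)))%C) 0 (2 * PI).
Proof.
  intros [dg Hg] Hs.
  assert (Hz0 := Cmod_ge_0 z).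
  assert (Hm : forall t, Cmod (circle s t) = s) by (intros t; apply Cmod_circle; lra).
  assert (Hne : forall t, (circle s t - z)%C <> RtoC 0).
  { intros t E; apply Ceq_minus in E; specialize (Hm t); rewrite E in Hm; lra. }
  set (K := fun t => (circle s t / (circle s t - z))%C).
  assert (CK : path_continuous K).
  { intros t; apply continuous_Cmult; [apply path_continuous_circle|].
    apply (continuous_comp (fun t => circle s t - z)%C Cinv).
    - apply continuous_Cminus; [apply path_continuous_circle|apply continuous_const].
    - eapply is_cderive_continuous, is_cderive_inv, Hne. }
  set (d := (1 - s) / 4).
  assert (Hd : 0 < d) by (unfold d; lra).
  set (p := fun u t => (z + RtoC u * (circle s t - z))%C).
  assert (Hp : forall u t, - d <= u <= 1 + d -> in_disk (p u t)).
  { intros u t Hu; apply segment_in_disk with s; try lra; [rewrite Hm; lra|exact Hu]. }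
  set (f := fun u t => Re (g (p u t) * K t)%C).
  set (h := fun u t => Re (circle s t * dg (p u t))%C).
  assert (Df : forall u t, - d <= u <= 1 + d -> is_derive (fun u => f u t) u (h u t)).
  { intros u t Hu; unfold f, h.
    replace (circle s t * dg (p u t))%C with ((circle s t - z) * (dg (p u t) * K t))%C
      by (unfold K; field; apply Hne).
    apply (is_derive_Re_line (fun w => g w * K t)%C).
    eapply is_cderive_eq; [apply is_cderive_mult; [apply Hg, (Hp u t Hu)|apply is_cderive_const]|].
    unfold p; ring. }
  assert (Cp : forall (T : UniformSpace) (a b : T -> R) x, continuous a x -> continuous b x ->
     @continuous T C_UniformSpace (fun y => p (a y) (b y)) x).
  { intros T a b x Ha Hb; unfold p.
    assert (Hcb : @continuous T C_UniformSpace (fun y => circle s (b y)) x).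
    { apply (continuous_comp b (circle s)); [exact Hb|apply path_continuous_circle]. }
    apply continuous_Cplus; [apply continuous_const|].
    apply continuous_Cmult; [now apply continuous_RtoC|].
    apply continuous_Cminus; [exact Hcb|apply continuous_const]. }
  assert (Loc : forall u, 0 <= u <= 1 -> locally u (fun v => - d <= v <= 1 + d)).
  { intros u Hu; exists (mkposreal d Hd); intros v Hv.
    change (Rabs (v - u) < d) in Hv; apply Rabs_lt_between' in Hv; lra. }
  assert (Dphi : forall u, 0 <= u <= 1 ->
     is_derive (fun u => RInt (fun t => f u t) 0 (2 * PI)) u zero).
  { intros u Hu.
    assert (Z : RInt (fun t => Derive (fun u => f u t) u) 0 (2 * PI) = 0).
    { rewrite (RInt_ext _ (h u)) by (intros t _; apply is_derive_unique, Df; lra).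
      unfold h; destruct (Req_dec u 0) as [->|Hu0].
      - rewrite (RInt_ext _ (fun t => Re (circle s t * (fun _ => dg z)
                   (RtoC 0 + RtoC 1 * (circle s t - RtoC 0)))%C)).
        + apply (RInt_holo_derivative_circle (fun w => w * dg z)%C (fun _ => dg z) (RtoC 0) s 1); [lra| |].
          * intros t; eapply is_cderive_eq;
              [apply is_cderive_mult; [apply is_cderive_id|apply is_cderive_const]|cbv beta; ring].
          * intros t; apply continuous_const.
        + intros t _; unfold p; do 3 f_equal; ring.
      - apply (RInt_holo_derivative_circle g dg z s u); [exact Hu0| |];
          intros t; apply Hg, Hp; lra. }
    apply (eq_ind _ (is_derive (fun u => RInt (fun t => f u t) 0 (2 * PI)) u)) with (2 := Z).
    apply is_derive_RInt_param.
    - generalize (Loc u Hu); apply filter_imp; intros v Hv t _; exists (h v t); now apply Df.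
    - intros t _.
      apply continuity_2d_pt_ext_loc with h.
      + exists (mkposreal d Hd); intros v r Hv _; simpl in Hv.
        apply Rabs_lt_between' in Hv; symmetry; apply is_derive_unique, Df; lra.
      + apply (continuous_continuity_2d (fun q => h (fst q) (snd q))).
        apply continuous_Re, continuous_Cmult.
        * apply (continuous_comp snd (circle s)); [apply continuous_snd|apply path_continuous_circle].
        * apply (continuous_comp (fun q => p (fst q) (snd q)) dg).
          -- apply Cp; [apply continuous_fst|apply continuous_snd].
          -- apply Hg, Hp; simpl; lra.
    - generalize (Loc u Hu); apply filter_imp; intros v Hv.
      apply ex_RInt_continuous_all; intros t; apply continuous_Re, continuous_Cmult; [|apply CK].
      apply (continuous_comp (fun t => p v t) g).
      + apply Cp; [apply continuous_const|apply continuous_id].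
      + eapply is_cderive_continuous, Hg, Hp, Hv. }
  assert (E := eq_is_derive _ 0 1 Dphi Rlt_0_1).
  symmetry; transitivity (RInt (fun t => f 0 t) 0 (2 * PI));
    [|rewrite E]; apply RInt_ext; intros t _; unfold f, p, K; do 3 f_equal; ring.
Qed.

Lemma circle_minus_neq_0 (z : C) (s t : R) : Cmod z < s -> (circle s t - z)%C <> RtoC 0.
Proof.
  intros Hz E; apply Ceq_minus in E.
  assert (Hm := Cmod_circle s t). assert (P := Cmod_ge_0 z).
  rewrite E in Hm; lra.
Qed.

Lemma path_continuous_inv (h : R -> C) :
  path_continuous h -> (forall t, h t <> RtoC 0) -> path_continuous (fun t => / h t)%C.
Proof.
  intros Hh H0 t; apply (continuous_comp h Cinv); [apply Hh|].
  eapply is_cderive_continuous, is_cderive_inv, H0.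
Qed.

Lemma path_continuous_const (k : C) : path_continuous (fun _ => k).
Proof. intros t; apply continuous_const. Qed.

Lemma path_continuous_mult (h k : R -> C) :
  path_continuous h -> path_continuous k -> path_continuous (fun t => h t * k t)%C.
Proof. intros Hh Hk t; now apply continuous_Cmult. Qed.

Lemma path_continuous_plus (h k : R -> C) :
  path_continuous h -> path_continuous k -> path_continuous (fun t => h t + k t)%C.
Proof. intros Hh Hk t; now apply continuous_Cplus. Qed.

Lemma path_continuous_minus (h k : R -> C) :
  path_continuous h -> path_continuous k -> path_continuous (fun t => h t - k t)%C.
Proof. intros Hh Hk t; now apply continuous_Cminus. Qed.

Lemma path_continuous_pow (h : R -> C) (n : nat) :
  path_continuous h -> path_continuous (fun t => h t ^ n)%C.
Proof.
  intros Hh; induction n as [|n IH]; [exact (path_continuous_const (RtoC 1))|].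
  exact (path_continuous_mult h _ Hh IH).
Qed.

Lemma path_continuous_conj (h : R -> C) :
  path_continuous h -> path_continuous (fun t => Cconj (h t)).
Proof.
  intros Hh t; apply continuous_pair.
  - apply continuous_Re, Hh.
  - apply (@continuous_opp R_UniformSpace R_AbsRing R_NormedModule), continuous_Im, Hh.
Qed.

Lemma path_continuous_kernel (z : C) (s : R) :
  Cmod z < s -> path_continuous (fun t => circle s t / (circle s t - z))%C.
Proof.
  intros Hz; apply path_continuous_mult; [apply path_continuous_circle|].
  apply path_continuous_inv; [|intros t; now apply circle_minus_neq_0].
  apply path_continuous_minus; [apply path_continuous_circle|apply path_continuous_const].
Qed.

Lemma path_continuous_inv_circle (s : R) (n : nat) :
  0 < s -> path_continuous (fun t => (/ circle s t) ^ n)%C.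
Proof.
  intros Hs; apply path_continuous_pow, path_continuous_inv; [apply path_continuous_circle|].
  intros t; now apply circle_neq_0.
Qed.

Lemma path_continuous_holo (g : C -> C) (s : R) :
  holo g -> 0 <= s < 1 -> path_continuous (fun t => g (circle s t)).
Proof.
  intros Hg Hs t; apply (continuous_comp (circle s) g); [apply path_continuous_circle|].
  apply holo_continuous; [exact Hg|]. unfold in_disk; rewrite Cmod_circle; lra.
Qed.

(** Cauchy's formula up to the mean of the kernel itself, which is found to be
    1 in [cmean_kernel]. *)
Lemma cmean_Cauchy_kernel (g : C -> C) (z : C) (s : R) :
  holo g -> Cmod z < s < 1 ->
  cmean (fun t => g (circle s t) * (circle s t / (circle s t - z)))%C =
  (g z * cmean (fun t => circle s t / (circle s t - z)))%C.
Proof.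
  intros Hg Hs; rewrite <- cmean_scal by (apply path_continuous_kernel; lra).
  unfold cmean; f_equal; f_equal; [now apply RInt_Cauchy_kernel|].
  (* imaginary parts are the real parts for the function multiplied by -i *)
  assert (E := RInt_Cauchy_kernel _ z s (holo_scal (- Ci)%C g Hg) Hs); cbv beta in E.
  assert (I : forall a b : C, Re (- Ci * a * b)%C = Im (a * b)%C)
    by (intros [a1 a2] [b1 b2]; unfold Re, Im, Cmult, Copp, Ci; simpl; ring).
  rewrite (RInt_ext _ (fun t => Im (g (circle s t) * (circle s t / (circle s t - z)))%C)) in E
    by (intros t _; apply I).
  rewrite E; apply RInt_ext; intros t _; apply I.
Qed.

Lemma cmean_holo (g : C -> C) (s : R) :
  holo g -> 0 < s < 1 -> cmean (fun t => g (circle s t)) = g (RtoC 0).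
Proof.
  intros Hg Hs; assert (E := cmean_Cauchy_kernel g (RtoC 0) s Hg).
  rewrite Cmod_0 in E; specialize (E Hs).
  assert (K : forall t, (circle s t / (circle s t - 0))%C = RtoC 1).
  { intros t; field; apply circle_neq_0; lra. }
  rewrite (cmean_ext _ (fun t => g (circle s t))) in E by (intros t; rewrite K; ring).
  rewrite E, (cmean_ext _ _ K), cmean_const; ring.
Qed.

Lemma holo_mult (f g : C -> C) : holo f -> holo g -> holo (fun z => f z * g z)%C.
Proof.
  intros [df Hf] [dg Hg]; exists (fun z => df z * g z + f z * dg z)%C.
  intros z Hz; destruct (Hf z Hz) as [Df Cf], (Hg z Hz) as [Dg Cg]; split.
  - now apply is_cderive_mult.
  - apply continuous_Cplus; apply continuous_Cmult; auto;
      eapply is_cderive_continuous; eassumption.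
Qed.

Lemma holo_plus (f g : C -> C) : holo f -> holo g -> holo (fun z => f z + g z)%C.
Proof.
  intros [df Hf] [dg Hg]; exists (fun z => df z + dg z)%C.
  intros z Hz; destruct (Hf z Hz) as [Df Cf], (Hg z Hz) as [Dg Cg]; split.
  - now apply is_cderive_plus.
  - now apply continuous_Cplus.
Qed.

Lemma holo_inv (f : C -> C) :
  holo f -> (forall z, in_disk z -> f z <> RtoC 0) -> holo (fun z => / f z)%C.
Proof.
  intros [df Hf] H0; exists (fun z => df z * - (/ f z * / f z))%C.
  intros z Hz; destruct (Hf z Hz) as [Df Cf]; split.
  - apply (is_cderive_comp Cinv f); [apply is_cderive_inv, H0, Hz|exact Df].
  - assert (Ci' : ccontinuous (fun z => / f z)%C z).
    { apply (continuous_comp f Cinv); [eapply is_cderive_continuous, Df|].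
      eapply is_cderive_continuous, is_cderive_inv, H0, Hz. }
    apply continuous_Cmult; [exact Cf|].
    apply (@continuous_opp C_UniformSpace C_AbsRing C_NormedModule).
    now apply continuous_Cmult.
Qed.

Lemma holo_const (k : C) : holo (fun _ => k).
Proof.
  exists (fun _ => RtoC 0); intros z _; split; [apply is_cderive_const|apply continuous_const].
Qed.

Lemma holo_id : holo (fun z => z).
Proof.
  exists (fun _ => RtoC 1); intros z _; split; [apply is_cderive_id|apply continuous_const].
Qed.

Lemma holo_pow (n : nat) : holo (fun z => z ^ n)%C.
Proof.
  induction n as [|n IH]; [exact (holo_const (RtoC 1))|exact (holo_mult _ _ holo_id IH)].
Qed.

Lemma holo_CPSeries (a : nat -> C) : disk_coeffs a -> holo (CPSeries a).
Proof.
  intros Ha; exists (CPSeries (dcoeffs a)); intros z Hz; split; [now apply CPSeries_is_cderive|].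
  apply CPSeries_continuous; [now apply disk_coeffs_dcoeffs|exact Hz].
Qed.

Lemma inv_circle (s t : R) : 0 < s ->
  (/ circle s t)%C = (RtoC (/ (s * s)) * Cconj (circle s t))%C.
Proof.
  intros Hs; assert (H := circle_neq_0 s t Hs).
  assert (E := Cmod2_conj (circle s t)); rewrite Cmod_circle in E by lra.
  apply (Cmult_eq_reg_l (circle s t) _ _ H).
  rewrite Cinv_r by exact H.
  transitivity (RtoC (/ (s * s)) * (circle s t * Cconj (circle s t)))%C; [|ring].
  rewrite <- E, <- RtoC_mult; f_equal; field; lra.
Qed.

(** On a circle [1 / z] is a multiple of the conjugate of [z], so this is the
    conjugate of the mean value property for [z ^ (n + 1)]. *)
Lemma cmean_inv_circle_pow (s : R) (n : nat) : 0 < s < 1 ->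
  cmean (fun t => (/ circle s t) ^ S n)%C = RtoC 0.
Proof.
  intros Hs.
  rewrite (cmean_ext _ (fun t => RtoC (/ (s * s)) ^ S n * Cconj (circle s t ^ S n)))%C.
  2:{ intros t; rewrite inv_circle, Cpow_mult_l, Cpow_conj by lra; reflexivity. }
  rewrite cmean_scal, cmean_conj.
  - rewrite (cmean_holo (fun z => z ^ S n)%C s (holo_pow (S n)) Hs), (Cpow_S (RtoC 0)), Cmult_0_l.
    replace (Cconj 0) with (RtoC 0) by (unfold Cconj, RtoC; simpl; f_equal; ring). ring.
  - apply path_continuous_pow, path_continuous_circle.
  - apply path_continuous_conj, path_continuous_pow, path_continuous_circle.
Qed.

Lemma is_series_C_geometric_remainder (u : nat -> C) (l : C) (M q : R) :
  0 <= q < 1 ->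
  (forall n, Cmod (l - @sum_n C_AbelianMonoid u n)%C <= M * q ^ n) ->
  @is_series C_AbsRing C_NormedModule u l.
Proof.
  intros Hq H.
  assert (L : is_lim_seq (fun n => M * q ^ n) 0).
  { replace (Finite 0) with (Rbar_mult M 0) by (simpl; f_equal; ring).
    apply is_lim_seq_scal_l, is_lim_seq_geom; rewrite Rabs_pos_eq; lra. }
  intros P HP; apply locally_C in HP; destruct HP as [e He].
  destruct (L _ (locally_ball 0 e)) as [N HN]; exists N; intros n Hn; apply He.
  specialize (HN n Hn); change (Rabs (M * q ^ n - 0) < e) in HN.
  change (Cmod (@sum_n C_AbelianMonoid u n - l)%C < e).
  rewrite Cmod_minus_sym; eapply Rle_lt_trans; [apply H|].
  eapply Rle_lt_trans; [|exact HN]. rewrite Rminus_0_r; apply Rle_abs.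
Qed.

(** Geometric expansion of the Cauchy kernel, integrated term by term. The
    kernel satisfies [K = 1 + (z / zeta) K], so the remainder after [n] terms
    is [z ^ (n + 1)] times another mean of the same form, and no interchange
    of sum and integral is needed. *)
Lemma Cauchy_kernel_series (h : R -> C) (z : C) (s : R) :
  path_continuous h -> Cmod z < s ->
  @is_series C_AbsRing C_NormedModule
    (fun n => cmean (fun t => h t * (/ circle s t) ^ n) * z ^ n)%C
    (cmean (fun t => h t * (circle s t / (circle s t - z)))%C).
Proof.
  intros Hh Hz; assert (Hz0 := Cmod_ge_0 z). assert (Hs : 0 < s) by lra.
  set (K := fun t => (circle s t / (circle s t - z))%C).
  assert (CK : path_continuous K) by (now apply path_continuous_kernel).
  assert (CI := fun n => path_continuous_inv_circle s n Hs).
  assert (HK : forall t, K t = (1 + z * / circle s t * K t)%C).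
  { intros t; unfold K; field; split;
      [now apply circle_minus_neq_0|now apply circle_neq_0]. }
  set (A := fun n => cmean (fun t => h t * (/ circle s t) ^ n * K t)%C).
  set (c := fun n => cmean (fun t => h t * (/ circle s t) ^ n)%C).
  assert (HA : forall n, A n = (c n + z * A (S n))%C).
  { intros n; unfold A, c; rewrite <- cmean_scal, <- cmean_plus.
    - apply cmean_ext; intros t; rewrite (HK t) at 1; rewrite Cpow_S; ring.
    - now apply path_continuous_mult.
    - apply path_continuous_mult; [apply path_continuous_const|].
      apply path_continuous_mult; [now apply path_continuous_mult|exact CK].
    - apply path_continuous_mult; [now apply path_continuous_mult|exact CK]. }
  replace (cmean _) with (A 0%nat) by (apply cmean_ext; intros t; simpl; unfold K; ring).
  assert (Sum : forall n, A 0%nat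
     = (@sum_n C_AbelianMonoid (fun k => c k * z ^ k)%C n + z ^ S n * A (S n))%C).
  { induction n as [|n IH].
    - rewrite sum_O, HA; simpl; ring.
    - rewrite IH, sum_Sn, (HA (S n)), !Cpow_S.
      change (plus ?x ?y) with (x + y)%C. ring. }
  set (M := Re (cmean (fun t => RtoC (Cmod (h t * K t)%C)))).
  assert (CM : forall t, continuous (fun t => Cmod (h t * K t)%C) t).
  { intros t; apply continuous_Cmod; now apply path_continuous_mult. }
  assert (BA : forall n, Cmod (A n) <= (/ s) ^ n * M).
  { intros n; unfold M, A. rewrite <- re_scal_l, <- cmean_scal by
      (intros t; apply continuous_RtoC, CM).
    rewrite (cmean_ext (fun t => RtoC ((/ s) ^ n) * _)%C
        (fun t => RtoC ((/ s) ^ n * Cmod (h t * K t)%C)))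
      by (intros t; rewrite RtoC_mult; reflexivity).
    apply Cmod_cmean_le.
    - apply path_continuous_mult; [now apply path_continuous_mult|exact CK].
    - intros t; apply (@continuous_scal_r R_UniformSpace R_AbsRing R_NormedModule), CM.
    - intros t; right.
      rewrite !Cmod_mult, Cmod_pow, Cmod_inv, Cmod_circle by (try apply circle_neq_0; lra).
      ring. }
  apply is_series_C_geometric_remainder with (M := M * (Cmod z / s)) (q := Cmod z / s).
  - split; [apply Rdiv_le_0_compat|apply Rlt_div_l]; lra.
  - intros n.
    assert (X : (A 0%nat - @sum_n C_AbelianMonoid (fun k => c k * z ^ k)%C n)%C
                = (z ^ S n * A (S n))%C) by (rewrite (Sum n); ring).
    change (Cmod (A 0%nat - @sum_n C_AbelianMonoid (fun k => c k * z ^ k)%C n)%C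
      <= M * (Cmod z / s) * (Cmod z / s) ^ n).
    rewrite X, Cmod_mult, Cmod_pow.
    eapply Rle_trans; [apply Rmult_le_compat_l; [apply pow_le, Hz0|apply BA]|].
    right; unfold Rdiv; rewrite Rpow_mult_distr; simpl; ring.
Qed.

Lemma cmean_kernel (z : C) (s : R) : Cmod z < s < 1 ->
  cmean (fun t => circle s t / (circle s t - z))%C = RtoC 1.
Proof.
  intros Hs; assert (Hz0 := Cmod_ge_0 z).
  assert (H := Cauchy_kernel_series (fun _ => RtoC 1) z s (path_continuous_const _) (proj1 Hs)).
  rewrite (cmean_ext _ (fun t => circle s t / (circle s t - z)))%C in H by (intros; ring).
  set (d := fun n => match n with O => RtoC 1 | S _ => RtoC 0 end).
  assert (E : cmean (fun t => circle s t / (circle s t - z))%C = CPSeries d z).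
  { apply is_series_CPSeries.
    eapply (@is_series_ext C_AbsRing C_NormedModule); [|exact H].
    intros n; cbv beta; f_equal; destruct n as [|n]; simpl d.
    - rewrite (cmean_ext _ (fun _ => RtoC 1)) by (intros; simpl; ring); apply cmean_const.
    - rewrite (cmean_ext _ (fun t => (/ circle s t) ^ S n))%C by (intros; ring).
      apply cmean_inv_circle_pow; lra. }
  rewrite E; symmetry; apply is_series_CPSeries.
  apply (is_series_C_geometric_remainder _ _ 0 0); [lra|]. intros n.
  replace (@sum_n C_AbelianMonoid (fun n => d n * z ^ n)%C n) with (RtoC 1).
  - replace (1 - 1)%C with (RtoC 0) by ring; rewrite Cmod_0; lra.
  - induction n as [|n IH]; [rewrite sum_O; simpl; ring|].
    rewrite sum_Sn, <- IH; change (plus ?x ?y) with (x + y)%C; simpl d; ring.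
Qed.

(** Taylor expansion of a holomorphic function on the whole disk. The
    coefficients read off the circle of radius 1/2 agree with those of any
    larger circle, since both represent the function near 0. *)
Theorem holo_power_series (g : C -> C) :
  holo g -> exists a, disk_coeffs a /\ forall z, in_disk z -> g z = CPSeries a z.
Proof.
  intros Hg.
  set (c := fun s n => cmean (fun t => g (circle s t) * (/ circle s t) ^ n)%C).
  assert (H : forall z s, Cmod z < s < 1 ->
    @is_series C_AbsRing C_NormedModule (fun n => c s n * z ^ n)%C (g z)).
  { intros z s Hs; assert (Hz0 := Cmod_ge_0 z).
    assert (HS := Cauchy_kernel_series (fun t => g (circle s t)) z s
       (path_continuous_holo g s Hg ltac:(lra)) (proj1 Hs)).
    cbv beta in HS; rewrite (cmean_Cauchy_kernel g z s Hg Hs), (cmean_kernel z s Hs), Cmult_1_r in HS.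
    exact HS. }
  assert (B : forall s, 0 < s < 1 -> exists K, forall n, Cmod (c s n) * s ^ n <= K).
  { intros s Hs; exists (Re (cmean (fun t => RtoC (Cmod (g (circle s t)))))); intros n.
    assert (Cg := path_continuous_holo g s Hg ltac:(lra)).
    assert (CM : forall t, continuous (fun t => Cmod (g (circle s t))) t)
      by (intros t; apply continuous_Cmod, Cg).
    apply Rmult_le_reg_r with ((/ s) ^ n); [apply pow_lt, Rinv_0_lt_compat; lra|].
    rewrite Rmult_assoc, <- Rpow_mult_distr, Rinv_r, pow1, Rmult_1_r by lra.
    rewrite Rmult_comm, <- re_scal_l, <- cmean_scal by (intros t; apply continuous_RtoC, CM).
    rewrite (cmean_ext (fun t => RtoC ((/ s) ^ n) * _)%C
        (fun t => RtoC ((/ s) ^ n * Cmod (g (circle s t)))))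
      by (intros t; rewrite RtoC_mult; reflexivity).
    apply Cmod_cmean_le.
    - apply path_continuous_mult; [exact Cg|apply path_continuous_inv_circle; lra].
    - intros t; apply (@continuous_scal_r R_UniformSpace R_AbsRing R_NormedModule), CM.
    - intros t; right.
      rewrite Cmod_mult, Cmod_pow, Cmod_inv, Cmod_circle by (try apply circle_neq_0; lra).
      ring. }
  set (a := c (1 / 2)).
  assert (Eq : forall s, 1 / 2 <= s < 1 -> forall n, c s n = a n).
  { intros s Hs n.
    assert (Scale : forall r, 1 / 2 <= r < 1 ->
       disk_coeffs (fun n => RtoC (1 / 2) ^ n * c r n)%C /\
       forall z, in_disk z -> CPSeries (fun n => RtoC (1 / 2) ^ n * c r n)%C z = g (RtoC (1 / 2) * z)%C).
    { intros r Hr; split.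
      - intros rho Hrho; destruct (B r) as [K HK]; [lra|]; exists K; intros k.
        eapply Rle_trans; [|apply (HK k)].
        rewrite Cmod_mult, Cmod_pow, Cmod_R, Rabs_pos_eq by lra.
        replace ((1 / 2) ^ k * Cmod (c r k) * rho ^ k)
          with (Cmod (c r k) * (1 / 2 * rho) ^ k) by (rewrite Rpow_mult_distr; ring).
        apply Rmult_le_compat_l; [apply Cmod_ge_0|apply pow_incr; nra].
      - intros z Hz; unfold in_disk in Hz; symmetry; apply is_series_CPSeries.
        assert (Hz0 := Cmod_ge_0 z).
        eapply (@is_series_ext C_AbsRing C_NormedModule); [|apply (H _ r)].
        + intros k; change ((c r k * (RtoC (1 / 2) * z) ^ k)%C
            = (RtoC (1 / 2) ^ k * c r k * z ^ k)%C).
          rewrite Cpow_mult_l; ring.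
        + rewrite Cmod_mult, Cmod_R, Rabs_pos_eq by lra; lra. }
    destruct (Scale s Hs) as [D1 E1]. destruct (Scale (1 / 2) ltac:(lra)) as [D2 E2].
    apply (Cmult_eq_reg_l (RtoC (1 / 2) ^ n)%C).
    - apply Cpow_nz; intros E; apply RtoC_inj in E; lra.
    - apply (CPSeries_inj _ _ D1 D2); intros z Hz; rewrite E1, E2 by exact Hz; reflexivity. }
  exists a; split.
  - intros rho Hrho.
    destruct (Rle_lt_dec (1 / 2) rho) as [L|L].
    + destruct (B rho Hrho) as [K HK]; exists K; intros n; rewrite <- (Eq rho); [apply HK|lra].
    + destruct (B (1 / 2) ltac:(lra)) as [K HK]; exists K; intros n.
      eapply Rle_trans; [|apply (HK n)].
      apply Rmult_le_compat_l; [apply Cmod_ge_0|apply pow_incr; lra].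
  - intros z Hz; apply is_series_CPSeries; unfold in_disk in Hz; assert (Hz0 := Cmod_ge_0 z).
    eapply (@is_series_ext C_AbsRing C_NormedModule); [|apply (H z ((1 + Cmod z) / 2)); lra].
    intros n; cbv beta; f_equal; apply Eq; lra.
Qed.

(** * Functions with positive real part *)

(** Peeling off the constant term, whose contribution has mean 0, lowers [n]. *)
Lemma cmean_CPSeries_coeff (n : nat) (s : R) : 0 < s < 1 ->
  forall a, disk_coeffs a ->
  cmean (fun t => CPSeries a (circle s t) * (/ circle s t) ^ n)%C = a n.
Proof.
  intros Hs; induction n as [|n IH]; intros a Ha.
  - rewrite (cmean_ext _ (fun t => CPSeries a (circle s t))) by (intros t; simpl; ring).
    rewrite (cmean_holo _ s (holo_CPSeries a Ha) Hs); now apply CPSeries_0.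
  - assert (Hsa := disk_coeffs_shift a Ha).
    rewrite (cmean_ext _ (fun t => a 0%nat * (/ circle s t) ^ S n
               + CPSeries (fun k => a (S k)) (circle s t) * (/ circle s t) ^ n))%C.
    + assert (C1 := path_continuous_inv_circle s (S n) (proj1 Hs)).
      assert (C2 := path_continuous_mult _ _ (path_continuous_const (a 0%nat)) C1).
      assert (C3 := path_continuous_mult _ _
         (path_continuous_holo _ s (holo_CPSeries _ Hsa) ltac:(lra))
         (path_continuous_inv_circle s n (proj1 Hs))).
      rewrite (cmean_plus _ _ C2 C3), (cmean_scal _ _ C1), (cmean_inv_circle_pow s n Hs), (IH _ Hsa).
      ring.
    + intros t; rewrite (CPSeries_shift a (circle s t) Ha), Cpow_S.
      * field; apply circle_neq_0; lra.
      * unfold in_disk; rewrite Cmod_circle; lra.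
Qed.

Lemma pow_scaled_le_1 (N : nat) (X : R) :
  (forall s, 0 < s < 1 -> s ^ N * X <= 1) -> X <= 1.
Proof.
  intros H; destruct (Rle_lt_dec X 1) as [L|L]; [exact L|exfalso].
  assert (Cn : continuity_pt (fun s => s ^ N * X) 1).
  { apply continuity_pt_mult; [apply derivable_continuous_pt, derivable_pt_pow|].
    apply continuity_pt_const; intros u v; reflexivity. }
  apply continuity_pt_locally with (eps := mkposreal (X - 1) ltac:(lra)) in Cn.
  destruct Cn as [d Hd].
  set (s := 1 - Rmin (1 / 2) (d / 2)).
  assert (Pd := cond_pos d).
  assert (M0 : 0 < Rmin (1 / 2) (d / 2)) by (apply Rmin_pos; lra).
  assert (M1 := Rmin_l (1 / 2) (d / 2)). assert (M2 := Rmin_r (1 / 2) (d / 2)).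
  specialize (H s ltac:(unfold s; lra)).
  specialize (Hd s); simpl in Hd; rewrite pow1 in Hd.
  assert (B : Rabs (s ^ N * X - 1 * X) < X - 1).
  { apply Hd; change (Rabs (s - 1) < d); unfold s.
    rewrite Rabs_left1; lra. }
  apply Rabs_def2 in B; lra.
Qed.

(** The numbers [a n] are the moments of a probability measure on the circle
    (up to the radial factor [s ^ n], which disappears as [s] tends to 1):
    its density is [1 + 2 Re (CPSeries a)]. The inequality bounds the covariance of
    two powers of the coordinate by their variances. *)
Lemma positive_real_part_covariance (a : nat -> C) (m n : nat) :
  disk_coeffs a -> a 0%nat = RtoC 0 ->
  (forall z, in_disk z -> 0 <= 1 + 2 * Re (CPSeries a z)) ->
  (1 <= m)%nat -> (1 <= n)%nat ->
  Cmod (a (m + n)%nat - a m * a n)%C <= 1 - Cmod (a m) * Cmod (a n).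
Proof.
  intros Ha Ha0 Hpos Hm Hn.
  assert (Hsc : forall s, 0 < s < 1 ->
    s ^ (m + n) * (Cmod (a (m + n)%nat - a m * a n)%C + Cmod (a m) * Cmod (a n)) <= 1).
  { intros s Hs.
    set (rho := fun t => 1 + 2 * Re (CPSeries a (circle s t))).
    assert (Hd : forall t, in_disk (circle s t)) by (intros t; unfold in_disk; rewrite Cmod_circle; lra).
    assert (Hrho : forall t, 0 <= rho t) by (intros t; apply Hpos, Hd).
    set (w := fun t => CPSeries a (circle s t)).
    assert (Cw : path_continuous w) by (apply (path_continuous_holo (CPSeries a)); [now apply holo_CPSeries|lra]).
    assert (Crho : forall t, continuous rho t).
    { intros t; apply (@continuous_plus R_UniformSpace R_AbsRing R_NormedModule); [apply continuous_const|].
      apply (@continuous_scal_r R_UniformSpace R_AbsRing R_NormedModule), continuous_Re, Cw. }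
    assert (CrhoC : path_continuous (fun t => RtoC (rho t))) by (intros t; apply continuous_RtoC, Crho).
    assert (Erho : forall t, RtoC (rho t) = (1 + w t + Cconj (w t))%C).
    { intros t; unfold rho, w; rewrite RtoC_plus, RtoC_mult, re_alt; field. }
    set (E := fun h : R -> C => cmean (fun t => RtoC (rho t) * h t)%C).
    assert (Eplus : forall h k, path_continuous h -> path_continuous k ->
       E (fun t => h t + k t)%C = (E h + E k)%C).
    { intros h k Hh Hk; unfold E; rewrite <- cmean_plus by (now apply path_continuous_mult).
      apply cmean_ext; intros; ring. }
    assert (Escal : forall k h, path_continuous h -> E (fun t => k * h t)%C = (k * E h)%C).
    { intros k h Hh; unfold E; rewrite <- cmean_scal by (now apply path_continuous_mult).
      apply cmean_ext; intros; ring. }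
    assert (Econj : forall h, path_continuous h -> E (fun t => Cconj (h t)) = Cconj (E h)).
    { intros h Hh; unfold E; rewrite <- cmean_conj by (now apply path_continuous_mult).
      apply cmean_ext; intros t; rewrite Cmult_conj; f_equal.
      unfold Cconj, RtoC; simpl; f_equal; ring. }
    set (U := fun t => (RtoC s * / circle s t)%C).
    assert (CU : path_continuous U).
    { apply path_continuous_mult; [apply path_continuous_const|].
      apply path_continuous_inv; [apply path_continuous_circle|].
      intros t; apply circle_neq_0; lra. }
    assert (MU : forall t, Cmod (U t) = 1).
    { intros t; unfold U; rewrite Cmod_mult, Cmod_R, Cmod_inv, Cmod_circle, Rabs_pos_eq
        by (try apply circle_neq_0; lra). field; lra. }
    assert (CUk : forall k, path_continuous (fun t => U t ^ k)%C) by (intros; now apply path_continuous_pow).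
    (* the conjugate half of the density contributes the conjugate of the mean
       of a holomorphic function vanishing at 0 *)
    assert (Mom : forall k, E (fun t => U t ^ k)%C
        = (cmean (fun t => U t ^ k) + RtoC s ^ k * a k)%C).
    { intros k; unfold E.
      rewrite (cmean_ext _ (fun t => (U t ^ k + RtoC s ^ k * (w t * (/ circle s t) ^ k))
          + Cconj ((RtoC (/ s)) ^ k * (w t * circle s t ^ k))))%C.
      - assert (C1 : path_continuous (fun t => w t * (/ circle s t) ^ k)%C)
          by (apply path_continuous_mult; [exact Cw|apply path_continuous_inv_circle; lra]).
        assert (C2 : path_continuous (fun t => w t * circle s t ^ k)%C)
          by (apply path_continuous_mult; [exact Cw|apply path_continuous_pow, path_continuous_circle]).
        assert (C3 := path_continuous_mult _ _ (path_continuous_const (RtoC s ^ k)%C) C1).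
        assert (C4 := path_continuous_mult _ _ (path_continuous_const (RtoC (/ s) ^ k)%C) C2).
        rewrite cmean_plus, cmean_plus, cmean_conj, !cmean_scal;
          auto using path_continuous_conj, path_continuous_plus.
        unfold w; rewrite (cmean_CPSeries_coeff k s Hs a Ha).
        rewrite (cmean_holo (fun z => CPSeries a z * z ^ k)%C s
                   (holo_mult _ _ (holo_CPSeries a Ha) (holo_pow k)) Hs).
        rewrite (CPSeries_0 a Ha), Ha0, Cmult_0_l, Cmult_0_r.
        replace (Cconj 0) with (RtoC 0) by (unfold Cconj, RtoC; simpl; f_equal; ring). ring.
      - intros t; rewrite Erho.
        replace (Cconj (RtoC (/ s) ^ k * (w t * circle s t ^ k))%C)
          with (Cconj (w t) * U t ^ k)%C.
        + unfold U; rewrite Cpow_mult_l; ring.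
        + rewrite !Cmult_conj, !Cpow_conj.
          transitivity (Cconj (w t) * (Cconj (RtoC (/ s)) * Cconj (circle s t)) ^ k)%C;
            [|rewrite Cpow_mult_l; ring].
          f_equal; f_equal; unfold U; rewrite inv_circle by lra.
          replace (Cconj (RtoC (/ s))) with (RtoC (/ s))
            by (unfold Cconj, RtoC; simpl; f_equal; ring).
          rewrite Cmult_assoc, <- RtoC_mult; f_equal; f_equal; field; lra. }
    set (b := fun k => (RtoC s ^ k * a k)%C).
    assert (E1 : E (fun _ => RtoC 1) = RtoC 1).
    { assert (M0 := Mom 0%nat); simpl in M0; rewrite M0, cmean_const, Ha0; ring. }
    assert (Ek : forall k, (1 <= k)%nat -> E (fun t => U t ^ k)%C = b k).
    { intros k Hk; destruct k as [|k]; [lia|].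
      rewrite Mom; unfold b.
      rewrite (cmean_ext _ (fun t => RtoC s ^ S k * (/ circle s t) ^ S k)%C)
        by (intros t; apply Cpow_mult_l).
      rewrite cmean_scal, cmean_inv_circle_pow by (try apply path_continuous_inv_circle; lra).
      ring. }
    assert (Econst : forall k, E (fun _ => k) = k).
    { intros k; transitivity (E (fun _ => k * 1)%C).
      - unfold E; apply cmean_ext; intros; ring.
      - rewrite (Escal k (fun _ => RtoC 1)), E1 by apply path_continuous_const; ring. }
    set (D := fun k t => (U t ^ k - b k)%C).
    assert (CD : forall k, path_continuous (D k))
      by (intros k; apply path_continuous_minus; [apply CUk|apply path_continuous_const]).
    assert (Cov : E (fun t => D m t * D n t)%C = (b (m + n)%nat - b m * b n)%C).
    { transitivity (E (fun t => (U t ^ (m + n) + ((- b n) * U t ^ m + (- b m) * U t ^ n)) + b m * b n)%C).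
      - unfold E; apply cmean_ext; intros t; unfold D; rewrite Cpow_add_r; ring.
      - assert (K1 := path_continuous_mult _ _ (path_continuous_const (- b n)%C) (CUk m)).
        assert (K2 := path_continuous_mult _ _ (path_continuous_const (- b m)%C) (CUk n)).
        rewrite Eplus, Eplus, Eplus, !Escal, Econst, !Ek by
          (auto using path_continuous_plus, path_continuous_const; lia).
        ring. }
    assert (Var : forall k, (1 <= k)%nat ->
       E (fun t => RtoC (Cmod (D k t) ^ 2)) = RtoC (1 - Cmod (b k) ^ 2)).
    { intros k Hk.
      transitivity (E (fun t => ((- Cconj (b k)) * U t ^ k
            + Cconj ((- Cconj (b k)) * U t ^ k)) + RtoC (1 + Cmod (b k) ^ 2))%C).
      - unfold E; apply cmean_ext; intros t; f_equal.
        assert (EU : (U t ^ k * Cconj (U t ^ k))%C = RtoC 1).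
        { rewrite <- Cmod2_conj, Cmod_pow, MU, pow1; f_equal; ring. }
        rewrite Cmod2_conj; unfold D.
        rewrite RtoC_plus, Cmod2_conj, Cminus_conj, Cmult_conj, Copp_conj, Cconj_conj.
        rewrite <- EU; ring.
      - assert (K1 := path_continuous_mult _ _ (path_continuous_const (- Cconj (b k))%C) (CUk k)).
        rewrite Eplus, Eplus, Econj, !Escal, Econst, Ek by
          (auto using path_continuous_plus, path_continuous_const, path_continuous_conj).
        rewrite Cmult_conj, Copp_conj, Cconj_conj.
        rewrite RtoC_minus, RtoC_plus, Cmod2_conj; ring. }
    (* the product of the two deviations is at most half the sum of their
       squares *)
    assert (Bound : Cmod (b (m + n)%nat - b m * b n)%C
        <= ((1 - Cmod (b m) ^ 2) + (1 - Cmod (b n) ^ 2)) / 2).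
    { rewrite <- Cov.
      eapply Rle_trans; [apply (Cmod_cmean_le _
         (fun t => rho t * (/ 2 * (Cmod (D m t) ^ 2 + Cmod (D n t) ^ 2))))|].
      - apply path_continuous_mult; [exact CrhoC|now apply path_continuous_mult].
      - assert (C2 : forall k t, continuous (fun t => Cmod (D k t) ^ 2) t).
        { intros k t; simpl; apply (@continuous_mult R_UniformSpace R_AbsRing);
            [apply continuous_Cmod, CD|].
          apply (@continuous_mult R_UniformSpace R_AbsRing);
            [apply continuous_Cmod, CD|apply continuous_const]. }
        intros t; apply (@continuous_mult R_UniformSpace R_AbsRing); [apply Crho|].
        apply (@continuous_scal_r R_UniformSpace R_AbsRing R_NormedModule).
        apply (@continuous_plus R_UniformSpace R_AbsRing R_NormedModule); apply C2.
      - intros t; rewrite !Cmod_mult, Cmod_R, Rabs_pos_eq by apply Hrho.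
        apply Rmult_le_compat_l; [apply Hrho|].
        assert (Q := pow2_ge_0 (Cmod (D m t) - Cmod (D n t))). lra.
      - right.
        assert (CM : forall k, path_continuous (fun t => RtoC (Cmod (D k t) ^ 2))).
        { intros k t; apply continuous_RtoC; simpl.
          apply (@continuous_mult R_UniformSpace R_AbsRing);
            [apply continuous_Cmod, CD|].
          apply (@continuous_mult R_UniformSpace R_AbsRing);
            [apply continuous_Cmod, CD|apply continuous_const]. }
        transitivity (Re (E (fun t => RtoC (/ 2) * (RtoC (Cmod (D m t) ^ 2) + RtoC (Cmod (D n t) ^ 2)))%C)).
        + f_equal; unfold E; apply cmean_ext; intros t.
          now rewrite RtoC_mult, RtoC_mult, RtoC_plus.
        + rewrite Escal, Eplus, !Var, <- RtoC_plus, <- RtoC_mult, re_RtoC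
            by auto using path_continuous_plus.
          field. }
    assert (Mb : forall k, Cmod (b k) = s ^ k * Cmod (a k)).
    { intros k; unfold b; rewrite Cmod_mult, Cmod_pow, Cmod_R, Rabs_pos_eq; lra. }
    replace (b (m + n)%nat - b m * b n)%C
      with (RtoC s ^ (m + n) * (a (m + n)%nat - a m * a n))%C in Bound
      by (unfold b; rewrite Cpow_add_r; ring).
    rewrite Cmod_mult, Cmod_pow, Cmod_R, (Rabs_pos_eq s) in Bound by lra.
    assert (Q := pow2_ge_0 (Cmod (b m) - Cmod (b n))).
    rewrite Rmult_plus_distr_l.
    replace (s ^ (m + n) * (Cmod (a m) * Cmod (a n))) with (Cmod (b m) * Cmod (b n))
      by (rewrite !Mb, pow_add; ring).
    lra. }
  apply pow_scaled_le_1 in Hsc; lra.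
Qed.

Lemma positive_real_part_coeff_le_1 (a : nat -> C) (n : nat) :
  disk_coeffs a -> a 0%nat = RtoC 0 ->
  (forall z, in_disk z -> 0 <= 1 + 2 * Re (CPSeries a z)) ->
  (1 <= n)%nat -> Cmod (a n) <= 1.
Proof.
  intros Ha Ha0 Hpos Hn.
  assert (H := positive_real_part_covariance a n n Ha Ha0 Hpos Hn Hn).
  assert (P := Cmod_ge_0 (a (n + n)%nat - a n * a n)%C). assert (Q := Cmod_ge_0 (a n)). nra.
Qed.

(** * Logarithmic coefficients *)

Lemma is_series_C_terms_bounded (u : nat -> C) (l : C) :
  @is_series C_AbsRing C_NormedModule u l -> exists K, forall n, Cmod (u n) <= K.
Proof.
  intros H.
  destruct (@filterlim_bounded C_AbsRing C_NormedModule (@sum_n C_AbelianMonoid u)) as [M HM].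
  { exists l; exact H. }
  assert (HM' : forall n, Cmod (@sum_n C_AbelianMonoid u n) <= M) by exact HM.
  exists (2 * M); intros n; destruct n as [|n].
  - assert (A := HM' 0%nat); rewrite sum_O in A.
    assert (P := Cmod_ge_0 (u 0%nat)); lra.
  - assert (A := HM' n). assert (B := HM' (S n)).
    replace (u (S n)) with (@sum_n C_AbelianMonoid u (S n) - @sum_n C_AbelianMonoid u n)%C.
    + eapply Rle_trans; [apply Cmod_triangle|]. rewrite Cmod_opp; lra.
    + rewrite sum_Sn; change (plus ?x ?y) with (x + y)%C; ring.
Qed.

Lemma disk_coeffs_unshift (a : nat -> C) :
  disk_coeffs (fun n => a (S n)) -> disk_coeffs a.
Proof.
  intros Ha rho Hr; destruct (Ha rho Hr) as [K HK]; exists (Cmod (a 0%nat) + K).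
  assert (P0 := Cmod_ge_0 (a 0%nat)).
  assert (HK0 : 0 <= K).
  { eapply Rle_trans; [|apply (HK 0%nat)]; simpl; rewrite Rmult_1_r; apply Cmod_ge_0. }
  intros n; destruct n as [|n]; [simpl pow; lra|].
  specialize (HK n); cbv beta in HK; change (rho ^ S n) with (rho * rho ^ n).
  assert (P := Cmod_ge_0 (a (S n))). assert (Q : 0 <= rho ^ n) by (apply pow_le; lra).
  assert (0 <= Cmod (a (S n)) * rho ^ n) by now apply Rmult_le_pos.
  nra.
Qed.

Lemma disk_coeffs_of_convergence (a : nat -> C) (g : C -> C) :
  (forall z, in_disk z -> @is_series C_AbsRing C_NormedModule (fun n => a n * z ^ n)%C (g z)) ->
  disk_coeffs a.
Proof.
  intros H rho Hr.
  assert (Mr : Cmod (RtoC rho) = rho) by (rewrite Cmod_R; apply Rabs_pos_eq; lra).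
  destruct (is_series_C_terms_bounded _ _ (H (RtoC rho) ltac:(unfold in_disk; lra))) as [K HK].
  exists K; intros n; specialize (HK n); cbv beta in HK.
  now rewrite Cmod_mult, Cmod_pow, Mr in HK.
Qed.

Lemma CPSeries_INR (a : nat -> C) (z : C) : disk_coeffs a -> in_disk z ->
  CPSeries (fun n => RtoC (INR n) * a n)%C z = (z * CPSeries (dcoeffs a) z)%C.
Proof.
  intros Ha Hz; rewrite CPSeries_shift by (try apply disk_coeffs_INR; assumption).
  simpl INR at 1; unfold dcoeffs; ring.
Qed.

(** Coefficients of the logarithm [L]; the value [gamma 0] must not enter. *)
Definition log_coeffs (gamma : nat -> C) (n : nat) : C :=
  match n with O => RtoC 0 | S _ => (2 * gamma n)%C end.

(** Coefficients of [z f' / f = 1 + z L']. *)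
Definition starlike_coeffs (gamma : nat -> C) (n : nat) : C :=
  match n with O => RtoC 1 | S _ => (RtoC (INR n) * log_coeffs gamma n)%C end.

Lemma log_branch_CPSeries (f : C -> C) (gamma : nat -> C) :
  f (RtoC 0) = RtoC 0 -> is_log_coeffs f gamma ->
  disk_coeffs (log_coeffs gamma) /\
  forall z, in_disk z -> f z = (z * Cexp (CPSeries (log_coeffs gamma) z))%C.
Proof.
  intros Hf0 [L [[_ [_ HL]] Hs]].
  assert (Hs' : forall z, in_disk z ->
     @is_series C_AbsRing C_NormedModule (fun n => log_coeffs gamma n * z ^ n)%C (L z)).
  { intros z Hz; apply (@is_series_decr_1 C_AbsRing C_NormedModule).
    change (@is_series C_AbsRing C_NormedModule
      (fun n => log_coeffs gamma (S n) * z ^ S n)%C (L z + - (0 * 1))%C).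
    replace (L z + - (0 * 1))%C with (L z) by ring.
    eapply (@is_series_ext C_AbsRing C_NormedModule); [|apply Hs, Hz].
    intros n; change ((2 * (gamma (S n) * z ^ S n))%C = (2 * gamma (S n) * z ^ S n)%C); ring. }
  split; [now apply (disk_coeffs_of_convergence _ L)|].
  intros z Hz; destruct (Ceq_dec z (RtoC 0)) as [->|Hz0]; [rewrite Hf0; ring|].
  rewrite <- (is_series_CPSeries _ _ _ (Hs' z Hz)), HL by assumption; field; exact Hz0.
Qed.

Lemma starlike_CPSeries (gamma : nat -> C) :
  disk_coeffs (log_coeffs gamma) ->
  disk_coeffs (starlike_coeffs gamma) /\
  forall z, in_disk z ->
    CPSeries (starlike_coeffs gamma) z = (1 + z * CPSeries (dcoeffs (log_coeffs gamma)) z)%C.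
Proof.
  intros Hl.
  assert (He : disk_coeffs (starlike_coeffs gamma))
    by (apply disk_coeffs_unshift, (disk_coeffs_dcoeffs _ Hl)).
  split; [exact He|]. intros z Hz; rewrite CPSeries_shift by assumption; reflexivity.
Qed.

(** Writing [f = z exp L], the function [z f'' / f'] becomes
    [z L' + z q' / q] with [q = 1 + z L'], which involves only power series
    converging in the whole disk. *)
Lemma log_derivative_of_derivative (f : C -> C) (gamma : nat -> C) :
  disk_coeffs (log_coeffs gamma) ->
  (forall z, in_disk z -> f z = (z * Cexp (CPSeries (log_coeffs gamma) z))%C) ->
  (forall z, in_disk z -> C_derive f z <> RtoC 0) ->
  forall z, in_disk z ->
    CPSeries (starlike_coeffs gamma) z <> RtoC 0 /\
    (z * C_derive (C_derive f) z / C_derive f z)%C =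
    (z * (CPSeries (dcoeffs (log_coeffs gamma)) z
          + CPSeries (dcoeffs (starlike_coeffs gamma)) z * / CPSeries (starlike_coeffs gamma) z))%C.
Proof.
  intros Hl Hf Hnz.
  destruct (starlike_CPSeries gamma Hl) as [He Eq].
  set (l := log_coeffs gamma) in *. set (e := starlike_coeffs gamma) in *.
  set (F1 := fun z => (Cexp (CPSeries l z) * CPSeries e z)%C).
  assert (D1 : forall z, in_disk z -> C_derive f z = F1 z).
  { intros z Hz; apply is_C_derive_unique.
    apply is_cderive_ext_disk with (fun w => w * Cexp (CPSeries l w))%C; [|exact Hz|].
    - intros w Hw; symmetry; now apply Hf.
    - eapply is_cderive_eq.
      + apply is_cderive_mult; [apply is_cderive_id|].
        apply (is_cderive_comp Cexp (CPSeries l)); [apply is_cderive_Cexp|now apply CPSeries_is_cderive].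
      + unfold F1; rewrite Eq by exact Hz; ring. }
  intros z Hz.
  assert (D2 : C_derive (C_derive f) z
     = (Cexp (CPSeries l z) * (CPSeries (dcoeffs l) z * CPSeries e z + CPSeries (dcoeffs e) z))%C).
  { apply is_C_derive_unique.
    apply is_cderive_ext_disk with F1; [|exact Hz|].
    - intros w Hw; symmetry; now apply D1.
    - eapply is_cderive_eq.
      + apply is_cderive_mult; [|now apply CPSeries_is_cderive].
        apply (is_cderive_comp Cexp (CPSeries l)); [apply is_cderive_Cexp|now apply CPSeries_is_cderive].
      + cbv beta; ring. }
  assert (N := Hnz z Hz); rewrite D1 in N by exact Hz.
  assert (Ne : CPSeries e z <> RtoC 0).
  { intros E; apply N; unfold F1; rewrite E; ring. }
  split; [exact Ne|].
  rewrite D2, D1 by exact Hz; unfold F1; field; split; [exact Ne|apply Cexp_neq_0].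
Qed.

(** The terms with [c^3] and [c^4] are grouped as differences that the
    covariance inequality controls; in [gamma5_formula] the term [c^4] is
    split into two halves for this purpose. *)
Record log_coeff_formulas (c : R) (a gamma : nat -> C) : Prop := {
  gamma1_formula : (4 * gamma 1%nat = c * a 1%nat)%C;
  gamma2_formula : (48 * gamma 2%nat = 4 * c * a 2%nat + c ^ 2 * a 1%nat ^ 2)%C;
  gamma3_formula : (48 * gamma 3%nat = 2 * c * a 3%nat + c ^ 2 * a 1%nat * a 2%nat)%C;
  gamma4_formula : (40 * gamma 4%nat = c * a 4%nat + c ^ 2 / 2 * a 1%nat * a 3%nat
     + 2 * c ^ 2 / 9 * a 2%nat ^ 2
     + c ^ 3 / 36 * a 1%nat ^ 2 * (a 2%nat - c / 4 * a 1%nat ^ 2))%C;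
  gamma5_formula : (60 * gamma 5%nat = c * a 5%nat + c ^ 2 / 2 * a 1%nat * a 4%nat
     + 5 * c ^ 2 / 12 * a 2%nat * a 3%nat
     + c ^ 3 / 24 * (a 1%nat ^ 2 * (a 3%nat - c / 4 * a 1%nat * a 2%nat)
                    + a 1%nat * a 2%nat * (a 2%nat - c / 4 * a 1%nat ^ 2)))%C }.

(** The recursion is the identity [(c s - (q - 1)) q = z q'] read off on the
    coefficients; the first five equations are triangular in
    [gamma 1, ..., gamma 5]. *)
Lemma log_coeff_formulas_of_recursion (c : R) (a gamma : nat -> C) :
  a 0%nat = RtoC 0 ->
  (forall n, RtoC (INR n) * starlike_coeffs gamma n
     = csum (fun k => (c * a k + - RtoC 1 * (RtoC (INR k) * log_coeffs gamma k))
                      * starlike_coeffs gamma (n - k)%nat) (S n))%C ->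
  log_coeff_formulas c a gamma.
Proof.
  intros Ha0 H.
  assert (H1 := H 1%nat). assert (H2 := H 2%nat). assert (H3 := H 3%nat).
  assert (H4 := H 4%nat). assert (H5 := H 5%nat). clear H.
  simpl in H1, H2, H3, H4, H5. rewrite Ha0 in *.
  replace (1 + 1 + 1 + 1 + 1) with 5 in * by ring.
  replace (1 + 1 + 1 + 1) with 4 in * by ring.
  replace (1 + 1 + 1) with 3 in * by ring.
  replace (1 + 1) with 2 in * by ring.
  assert (Solve : forall x u v k : C, u = v -> (x = k * (u - v))%C -> x = RtoC 0)
    by (intros x u v k -> ->; ring).
  assert (G1 : gamma 1%nat = (c * a 1%nat / 4)%C).
  { apply Ceq_minus, (Solve _ _ _ (1 / 4)%C H1); field. }
  assert (G2 : gamma 2%nat = ((4 * c * a 2%nat + c ^ 2 * a 1%nat ^ 2) / 48)%C).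
  { apply Ceq_minus, (Solve _ _ _ (1 / 12)%C H2); rewrite G1; field. }
  assert (G3 : gamma 3%nat = ((2 * c * a 3%nat + c ^ 2 * a 1%nat * a 2%nat) / 48)%C).
  { apply Ceq_minus, (Solve _ _ _ (1 / 24)%C H3); rewrite G1, G2; field. }
  constructor.
  - rewrite G1; field.
  - rewrite G2; field.
  - rewrite G3; field.
  - apply Ceq_minus, (Solve _ _ _ (RtoC 1) H4); rewrite G1, G2, G3; field.
  - apply Ceq_minus, (Solve _ _ _ (RtoC 1) H5).
    assert (G4 : gamma 4%nat = ((c * a 4%nat + c ^ 2 / 2 * a 1%nat * a 3%nat
       + 2 * c ^ 2 / 9 * a 2%nat ^ 2
       + c ^ 3 / 36 * a 1%nat ^ 2 * (a 2%nat - c / 4 * a 1%nat ^ 2)) / 40)%C).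
    { apply Ceq_minus, (Solve _ _ _ (1 / 40)%C H4); rewrite G1, G2, G3; field. }
    rewrite G1, G2, G3, G4; field.
Qed.

(** The same sequence [a] serves two purposes: [1 + 2 CPSeries a] has positive real
    part, and the logarithmic coefficients are polynomials in [a]. *)
Lemma class_F_log_coeffs (c : R) (f : C -> C) (gamma : nat -> C) :
  0 < c -> class_F c f -> is_log_coeffs f gamma ->
  exists a, disk_coeffs a /\ a 0%nat = RtoC 0 /\
    (forall z, in_disk z -> 0 <= 1 + 2 * Re (CPSeries a z)) /\
    (forall z, in_disk z ->
       (z * C_derive (C_derive f) z / C_derive f z)%C = (RtoC c * CPSeries a z)%C) /\
    log_coeff_formulas c a gamma.
Proof.
  intros Hc [[_ [Hf0 _]] HF] Hg.
  assert (Hc' : RtoC c <> RtoC 0) by (intros E; apply RtoC_inj in E; lra).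
  destruct (log_branch_CPSeries f gamma Hf0 Hg) as [Hl Hf].
  destruct (starlike_CPSeries gamma Hl) as [He Eq].
  assert (Hphi := log_derivative_of_derivative f gamma Hl Hf (fun z Hz => proj1 (HF z Hz))).
  set (l := log_coeffs gamma) in *. set (e := starlike_coeffs gamma) in *.
  set (phi := fun z => (RtoC (/ c) * (z * (CPSeries (dcoeffs l) z + CPSeries (dcoeffs e) z * / CPSeries e z)))%C).
  assert (Hphi' : forall z, in_disk z ->
     (z * C_derive (C_derive f) z / C_derive f z)%C = (RtoC c * phi z)%C).
  { intros z Hz; rewrite (proj2 (Hphi z Hz)); unfold phi.
    rewrite Cmult_assoc, <- RtoC_mult, Rinv_r by lra; ring. }
  destruct (holo_power_series phi) as [a [Ha Ea]].
  { apply holo_scal, holo_mult; [apply holo_id|].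
    apply holo_plus; [now apply holo_CPSeries, disk_coeffs_dcoeffs|].
    apply holo_mult; [now apply holo_CPSeries, disk_coeffs_dcoeffs|].
    apply holo_inv; [now apply holo_CPSeries|]. intros z Hz; apply (Hphi z Hz). }
  assert (Ha0 : a 0%nat = RtoC 0).
  { rewrite <- (CPSeries_0 a Ha), <- Ea by apply in_disk_0; unfold phi; ring. }
  exists a; split; [exact Ha|split; [exact Ha0|split; [|split]]].
  - intros z Hz; destruct (HF z Hz) as [_ H].
    rewrite Hphi', Ea, re_plus, re_scal_l, re_RtoC in H by exact Hz.
    assert (0 < c * (1 / 2 + Re (CPSeries a z))) by lra.
    assert (0 < 1 / 2 + Re (CPSeries a z)); [|lra].
    apply Rmult_lt_reg_l with c; [exact Hc|lra].
  - intros z Hz; now rewrite Hphi', Ea.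
  - apply log_coeff_formulas_of_recursion; [exact Ha0|].
    intros n.
    assert (HQ := disk_coeffs_INR l Hl).
    assert (Hca := disk_coeffs_scal (RtoC c) a Ha).
    assert (HmQ := disk_coeffs_scal (- RtoC 1)%C _ HQ).
    assert (HIe := disk_coeffs_INR e He).
    apply (CPSeries_mult_coeffs e n He _ _ (disk_coeffs_plus _ _ Hca HmQ) HIe).
    intros z Hz.
    rewrite (CPSeries_plus _ _ z Hca HmQ Hz), (CPSeries_scal _ a z Ha Hz), (CPSeries_scal _ _ z HQ Hz).
    rewrite (CPSeries_INR l z Hl Hz), (CPSeries_INR e z He Hz), <- Ea by exact Hz.
    destruct (Hphi z Hz) as [Ne _]; unfold phi.
    rewrite (Cmult_assoc (RtoC c)), <- RtoC_mult, Rinv_r by lra.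
    field; exact Ne.
Qed.

(** * Bounds *)

Record moment_bounds (a : nat -> C) : Prop := {
  coeff_le_1 : forall n, (1 <= n)%nat -> Cmod (a n) <= 1;
  second_moment_bound : Cmod (a 2%nat - a 1%nat ^ 2)%C <= 1 - Cmod (a 1%nat) ^ 2;
  third_moment_bound :
    Cmod (a 3%nat - a 1%nat * a 2%nat)%C <= 1 - Cmod (a 1%nat) * Cmod (a 2%nat) }.

Lemma positive_real_part_moment_bounds (a : nat -> C) :
  disk_coeffs a -> a 0%nat = RtoC 0 ->
  (forall z, in_disk z -> 0 <= 1 + 2 * Re (CPSeries a z)) -> moment_bounds a.
Proof.
  intros Ha Ha0 Hpos; constructor.
  - intros n; now apply positive_real_part_coeff_le_1.
  - assert (H := positive_real_part_covariance a 1 1 Ha Ha0 Hpos (le_n _) (le_n _)).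
    replace (a 1%nat ^ 2)%C with (a 1%nat * a 1%nat)%C by ring.
    replace (Cmod (a 1%nat) ^ 2) with (Cmod (a 1%nat) * Cmod (a 1%nat)) by ring. exact H.
  - apply (positive_real_part_covariance a 1 2 Ha Ha0 Hpos); lia.
Qed.

Lemma Cmod_RtoC_pos (r : R) : 0 <= r -> Cmod (RtoC r) = r.
Proof. intros Hr; rewrite Cmod_R; now apply Rabs_pos_eq. Qed.

(** [u - lam v] is [u - v] plus the multiple [1 - lam] of [v], so for [lam] in
    [0, 1] the loss [m] is only scaled by [lam]. *)
Lemma Cmod_interpolation (u v : C) (lam m : R) :
  0 <= lam <= 1 -> Cmod (u - v)%C <= 1 - m -> Cmod v <= m ->
  Cmod (u - RtoC lam * v)%C <= 1 - lam * m.
Proof.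
  intros Hl Huv Hv.
  replace (u - RtoC lam * v)%C with ((u - v) + RtoC (1 - lam) * v)%C
    by (rewrite RtoC_minus; ring).
  eapply Rle_trans; [apply Cmod_triangle|].
  rewrite Cmod_mult, Cmod_RtoC_pos by lra.
  assert ((1 - lam) * Cmod v <= (1 - lam) * m) by (apply Rmult_le_compat_l; lra). lra.
Qed.

Lemma gamma_low_bounds (c : R) (a gamma : nat -> C) :
  0 < c <= 3 -> moment_bounds a -> log_coeff_formulas c a gamma ->
  Cmod (gamma 1%nat) <= c / 4 /\
  Cmod (gamma 2%nat) <= 1 / 48 * (4 * c + c ^ 2) /\
  Cmod (gamma 3%nat) <= 1 / 48 * (2 * c + c ^ 2).
Proof.
  intros Hc [Hle _ _] [H1 H2 H3 _ _].
  assert (A1 := Hle 1%nat ltac:(lia)). assert (A2 := Hle 2%nat ltac:(lia)).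
  assert (A3 := Hle 3%nat ltac:(lia)).
  assert (P1 := Cmod_ge_0 (a 1%nat)). assert (P2 := Cmod_ge_0 (a 2%nat)).
  assert (Pc : 0 <= c ^ 2) by nra.
  apply (f_equal Cmod) in H1, H2, H3.
  rewrite !Cmod_mult, !Cmod_RtoC_pos in H1 by lra.
  rewrite Cmod_mult, Cmod_RtoC_pos in H2, H3 by lra.
  split; [|split].
  - nra.
  - assert (T := Cmod_triangle (4 * c * a 2%nat)%C (c ^ 2 * a 1%nat ^ 2)%C).
    rewrite !Cmod_mult, !Cmod_pow, !Cmod_RtoC_pos in T by lra.
    assert (Cmod (a 1%nat) ^ 2 <= 1) by nra. nra.
  - assert (T := Cmod_triangle (2 * c * a 3%nat)%C (c ^ 2 * a 1%nat * a 2%nat)%C).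
    rewrite !Cmod_mult, !Cmod_pow, !Cmod_RtoC_pos in T by lra.
    assert (Cmod (a 1%nat) * Cmod (a 2%nat) <= 1) by nra. nra.
Qed.

Lemma gamma4_bound (c : R) (a gamma : nat -> C) :
  0 < c <= 3 -> moment_bounds a -> log_coeff_formulas c a gamma ->
  Cmod (gamma 4%nat) <= 1 / 40 * (c + c ^ 2 / 18 * (13 + c / 2 - c ^ 2 / 8)).
Proof.
  intros Hc [Hle H2 _] [_ _ _ H4 _].
  assert (A1 := Hle 1%nat ltac:(lia)). assert (A2 := Hle 2%nat ltac:(lia)).
  assert (A3 := Hle 3%nat ltac:(lia)). assert (A4 := Hle 4%nat ltac:(lia)).
  assert (P1 := Cmod_ge_0 (a 1%nat)). assert (P2 := Cmod_ge_0 (a 2%nat)).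
  assert (P3 := Cmod_ge_0 (a 3%nat)).
  assert (K : Cmod (a 2%nat - c / 4 * a 1%nat ^ 2)%C <= 1 - c / 4 * Cmod (a 1%nat) ^ 2).
  { replace (c / 4)%C with (RtoC (c / 4)) by (rewrite RtoC_div by lra; reflexivity).
    apply Cmod_interpolation; [lra|exact H2|rewrite Cmod_pow; lra]. }
  apply (f_equal Cmod) in H4; rewrite Cmod_mult, Cmod_RtoC_pos in H4 by lra.
  set (x := Cmod (a 1%nat)) in *.
  assert (B : 40 * Cmod (gamma 4%nat)
     <= c + c ^ 2 / 2 * x + 2 * c ^ 2 / 9 + c ^ 3 / 36 * (x ^ 2 * (1 - c / 4 * x ^ 2))).
  { rewrite H4.
    replace (c ^ 2 / 2)%C with (RtoC (c ^ 2 / 2)) by (rewrite RtoC_div, RtoC_pow by lra; reflexivity).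
    replace (2 * c ^ 2 / 9)%C with (RtoC (2 * c ^ 2 / 9))
      by (rewrite RtoC_div, RtoC_mult, RtoC_pow by lra; reflexivity).
    replace (c ^ 3 / 36)%C with (RtoC (c ^ 3 / 36)) by (rewrite RtoC_div, RtoC_pow by lra; reflexivity).
    assert (C2 : 0 <= c ^ 2 / 2) by nra. assert (C3 : 0 <= c ^ 3 / 36) by nra.
    assert (C4 : 0 <= 2 * c ^ 2 / 9) by nra.
    repeat (eapply Rle_trans; [apply Cmod_triangle|]; apply Rplus_le_compat).
    - rewrite Cmod_mult, Cmod_RtoC_pos by lra; nra.
    - rewrite !Cmod_mult, Cmod_RtoC_pos by lra; fold x.
      assert (x * Cmod (a 3%nat) <= x) by nra.
      rewrite Rmult_assoc; now apply Rmult_le_compat_l.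
    - rewrite !Cmod_mult, Cmod_pow, Cmod_RtoC_pos by lra.
      assert (Cmod (a 2%nat) ^ 2 <= 1) by nra. nra.
    - rewrite !Cmod_mult, Cmod_pow, Cmod_RtoC_pos by lra; fold x.
      rewrite Rmult_assoc; apply Rmult_le_compat_l; [exact C3|].
      apply Rmult_le_compat_l; [apply pow2_ge_0|exact K]. }
  (* the bound increases with x on [0, 1] *)
  assert (M : 0 <= (1 - x) * (1 / 2 + c / 36 * ((1 + x) * (1 - c / 4 * (1 + x ^ 2))))).
  { apply Rmult_le_pos; [lra|].
    assert (x ^ 2 <= 1) by nra. assert (0 <= x ^ 2) by nra.
    assert (- (1 / 2) <= 1 - c / 4 * (1 + x ^ 2)) by nra.
    assert (- 1 <= (1 + x) * (1 - c / 4 * (1 + x ^ 2))) by nra. nra. }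
  assert (Pc : 0 <= c ^ 2) by nra.
  assert (M' := Rmult_le_pos _ _ Pc M). lra.
Qed.

Lemma gamma5_bound (c : R) (a gamma : nat -> C) :
  0 < c <= 3 -> moment_bounds a -> log_coeff_formulas c a gamma ->
  Cmod (gamma 5%nat) <= 1 / 60 * (c + c ^ 2 / 12 * (11 + c - c ^ 2 / 4)).
Proof.
  intros Hc [Hle H2 H3] [_ _ _ _ H5].
  assert (A1 := Hle 1%nat ltac:(lia)). assert (A2 := Hle 2%nat ltac:(lia)).
  assert (A3 := Hle 3%nat ltac:(lia)). assert (A4 := Hle 4%nat ltac:(lia)).
  assert (A5 := Hle 5%nat ltac:(lia)).
  assert (P1 := Cmod_ge_0 (a 1%nat)). assert (P2 := Cmod_ge_0 (a 2%nat)).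
  assert (P3 := Cmod_ge_0 (a 3%nat)). assert (P4 := Cmod_ge_0 (a 4%nat)).
  assert (E4 : (c / 4)%C = RtoC (c / 4)) by (rewrite RtoC_div by lra; reflexivity).
  assert (K2 : Cmod (a 2%nat - c / 4 * a 1%nat ^ 2)%C <= 1 - c / 4 * Cmod (a 1%nat) ^ 2).
  { rewrite E4; apply Cmod_interpolation; [lra|exact H2|rewrite Cmod_pow; lra]. }
  assert (K3 : Cmod (a 3%nat - c / 4 * a 1%nat * a 2%nat)%C
      <= 1 - c / 4 * (Cmod (a 1%nat) * Cmod (a 2%nat))).
  { rewrite E4, <- Cmult_assoc; apply Cmod_interpolation; [lra|exact H3|rewrite Cmod_mult; lra]. }
  apply (f_equal Cmod) in H5; rewrite Cmod_mult, Cmod_RtoC_pos in H5 by lra.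
  set (x := Cmod (a 1%nat)) in *. set (y := Cmod (a 2%nat)) in *.
  assert (B : 60 * Cmod (gamma 5%nat)
     <= c + c ^ 2 / 2 * x + 5 * c ^ 2 / 12 * y
        + c ^ 3 / 24 * (x ^ 2 * (1 - c / 4 * (x * y)) + x * y * (1 - c / 4 * x ^ 2))).
  { rewrite H5.
    replace (c ^ 2 / 2)%C with (RtoC (c ^ 2 / 2)) by (rewrite RtoC_div, RtoC_pow by lra; reflexivity).
    replace (5 * c ^ 2 / 12)%C with (RtoC (5 * c ^ 2 / 12))
      by (rewrite RtoC_div, RtoC_mult, RtoC_pow by lra; reflexivity).
    replace (c ^ 3 / 24)%C with (RtoC (c ^ 3 / 24)) by (rewrite RtoC_div, RtoC_pow by lra; reflexivity).
    assert (C2 : 0 <= c ^ 2 / 2) by nra. assert (C3 : 0 <= c ^ 3 / 24) by nra.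
    assert (C4 : 0 <= 5 * c ^ 2 / 12) by nra.
    eapply Rle_trans; [apply Cmod_triangle|]; apply Rplus_le_compat.
    - repeat (eapply Rle_trans; [apply Cmod_triangle|]; apply Rplus_le_compat).
      + rewrite Cmod_mult, Cmod_RtoC_pos by lra; nra.
      + rewrite !Cmod_mult, Cmod_RtoC_pos by lra; fold x.
        assert (x * Cmod (a 4%nat) <= x) by nra.
        rewrite Rmult_assoc; now apply Rmult_le_compat_l.
      + rewrite !Cmod_mult, Cmod_RtoC_pos by lra; fold y.
        assert (y * Cmod (a 3%nat) <= y) by nra.
        rewrite Rmult_assoc; now apply Rmult_le_compat_l.
    - rewrite Cmod_mult, Cmod_RtoC_pos by lra.
      apply Rmult_le_compat_l; [exact C3|].
      eapply Rle_trans; [apply Cmod_triangle|]; rewrite !Cmod_mult, Cmod_pow; fold x y.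
      apply Rplus_le_compat; apply Rmult_le_compat_l; try assumption;
        [apply pow2_ge_0|now apply Rmult_le_pos]. }
  assert (X2 : x ^ 2 <= 1) by nra. assert (X2' : 0 <= x ^ 2) by nra.
  (* the bound increases with y, then with x *)
  assert (My : 0 <= (1 - y) * (5 / 12 + c / 24 * (x * (1 - c / 2 * x ^ 2)))).
  { apply Rmult_le_pos; [lra|].
    assert (- (1 / 2) <= 1 - c / 2 * x ^ 2) by nra.
    assert (- (1 / 2) <= x * (1 - c / 2 * x ^ 2)) by nra. nra. }
  assert (Mx : 0 <= (1 - x) * (1 / 2 + c / 24 * (2 + x - c / 2 * (1 + x + x ^ 2)))).
  { apply Rmult_le_pos; [lra|].
    assert (c / 2 * (1 + x + x ^ 2) <= 3 / 2 * (1 + x + x ^ 2)) by (apply Rmult_le_compat_r; lra).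
    assert (- (3 / 2) <= 2 + x - c / 2 * (1 + x + x ^ 2)) by lra. nra. }
  assert (Pc : 0 <= c ^ 2) by nra.
  assert (My' := Rmult_le_pos _ _ Pc My). assert (Mx' := Rmult_le_pos _ _ Pc Mx). lra.
Qed.

Lemma le_mult_sqrt (A B v : R) :
  0 <= A -> 0 <= B -> 0 <= v -> v ^ 2 <= A ^ 2 * B -> v <= A * sqrt B.
Proof.
  intros HA HB Hv H.
  rewrite <- (sqrt_pow2 v Hv), <- (sqrt_pow2 A HA) at 1.
  rewrite <- sqrt_mult by (try apply pow2_ge_0; exact HB).
  now apply sqrt_le_1_alt.
Qed.

(** The left side is the coefficient that [M2 c] replaces in the polynomial
    bound. After squaring, both sides are estimated by their values at the
    left end of the range, except for [288 + 8 c - c^2], which is at most its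
    value 303 at [c = 3]; 1.048443 is the left side at [c = 2.71569],
    rounded up. *)
Lemma M2_ge (c : R) : 2.71569 < c <= 3 -> 1 + c / 18 - c ^ 2 / 72 <= M2 c.
Proof.
  intros Hc; unfold M2.
  assert (D : 0 < 288 + 8 * c - c ^ 2 <= 303) by nra.
  apply le_mult_sqrt; [lra|apply Rdiv_le_0_compat; lra|nra|].
  replace (((54 + c) / 27) ^ 2 * (4 * (54 + c) / (3 * (288 + 8 * c - c ^ 2))))
    with (4 * (54 + c) ^ 3 / 2187 / (288 + 8 * c - c ^ 2)) by (field; lra).
  apply -> Rle_div_r; [|lra].
  set (v := 1 + c / 18 - c ^ 2 / 72).
  assert (V : 0 <= v <= 1.048443) by (unfold v; nra).
  assert (V2 : v ^ 2 <= 1.048443 ^ 2) by nra.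
  apply Rle_trans with (1.048443 ^ 2 * 303); [apply Rmult_le_compat; nra|].
  apply Rle_trans with (4 * 56.71569 ^ 3 / 2187); [lra|].
  assert (56.71569 ^ 3 <= (54 + c) ^ 3) by (apply pow_incr; lra). lra.
Qed.

(** As for [M2_ge], except that the maximum 84 of [80 + 4 c - c^2] is too
    large near the left end of the range; hence the split at 1.5. The number
    1.043685 is the left side at [c = 1.35541], rounded up. *)
Lemma M3_ge (c : R) : 1.35541 < c <= 3 -> 1 + c / 10 - c ^ 2 / 20 <= M3 c.
Proof.
  intros Hc; unfold M3.
  assert (D : 0 < 80 + 4 * c - c ^ 2) by nra.
  assert (D84 : 80 + 4 * c - c ^ 2 <= 84) by (assert (Q := pow2_ge_0 (c - 2)); lra).
  apply le_mult_sqrt; [lra|apply Rdiv_le_0_compat; lra|nra|].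
  replace (((30 + c) / 15) ^ 2 * (2 * (30 + c) / (3 * (80 + 4 * c - c ^ 2))))
    with (2 * (30 + c) ^ 3 / 675 / (80 + 4 * c - c ^ 2)) by (field; lra).
  apply -> Rle_div_r; [|lra].
  set (v := 1 + c / 10 - c ^ 2 / 20).
  assert (V0 : 0 <= v) by (unfold v; nra).
  destruct (Rle_lt_dec c 1.5) as [L|L].
  - assert (V : v <= 1.043685) by (unfold v; nra).
    assert (V2 : v ^ 2 <= 1.043685 ^ 2) by nra.
    apply Rle_trans with (1.043685 ^ 2 * 83.75); [apply Rmult_le_compat; nra|].
    apply Rle_trans with (2 * 31.35541 ^ 3 / 675); [lra|].
    assert (31.35541 ^ 3 <= (30 + c) ^ 3) by (apply pow_incr; lra). lra.
  - assert (V : v <= 1.0375) by (unfold v; nra).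
    assert (V2 : v ^ 2 <= 1.0375 ^ 2) by nra.
    apply Rle_trans with (1.0375 ^ 2 * 84); [apply Rmult_le_compat; try lra; apply pow2_ge_0|].
    apply Rle_trans with (2 * 31.5 ^ 3 / 675); [lra|].
    assert (31.5 ^ 3 <= (30 + c) ^ 3) by (apply pow_incr; lra). lra.
Qed.

(** * The extremal function *)

(** The disk is star-shaped about the origin. *)
Lemma cderive_zero_const (g : C -> C) (z : C) :
  (forall w, in_disk w -> is_cderive g w (RtoC 0)) -> in_disk z -> g z = g (RtoC 0).
Proof.
  intros Hg Hz.
  assert (Hs : forall u, 0 <= u <= 1 -> in_disk (RtoC 0 + RtoC u * z)%C).
  { intros u Hu; unfold in_disk in *; rewrite Cplus_0_l, Cmod_mult, Cmod_RtoC_pos by lra.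
    assert (P := Cmod_ge_0 z); nra. }
  assert (Hre : forall h : C -> C, (forall w, in_disk w -> is_cderive h w (RtoC 0)) ->
     Re (h z) = Re (h (RtoC 0))).
  { intros h Hh.
    assert (E := eq_is_derive (fun u : R => Re (h (RtoC 0 + RtoC u * z)%C)) 0 1); cbv beta in E.
    replace (RtoC 0 + RtoC 0 * z)%C with (RtoC 0) in E by ring.
    replace (RtoC 0 + RtoC 1 * z)%C with z in E by ring.
    symmetry; apply E; [|lra]. intros u Hu.
    replace (@zero R_NormedModule) with (Re (z * RtoC 0)%C) by (rewrite Cmult_0_r; reflexivity).
    apply is_derive_Re_line, Hh, Hs, Hu. }
  assert (I : forall w, Re (- Ci * w)%C = Im w)
    by (intros [x y]; unfold Re, Im, Cmult, Copp, Ci; simpl; ring).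
  assert (E1 := Hre g Hg).
  assert (E2 := Hre (fun w => - Ci * g w)%C); cbv beta in E2; rewrite !I in E2.
  assert (E3 : Im (g z) = Im (g (RtoC 0))).
  { apply E2; intros w Hw; eapply is_cderive_eq;
      [apply is_cderive_mult; [apply is_cderive_const|apply Hg, Hw]|cbv beta; ring]. }
  destruct (g z), (g (RtoC 0)); simpl in E1, E3; now subst.
Qed.

Lemma CPSeries_ext (a b : nat -> C) (z : C) :
  (forall n, a n = b n) -> CPSeries a z = CPSeries b z.
Proof.
  intros H; unfold CPSeries; f_equal; apply Series_ext; intros n; now rewrite H.
Qed.

Lemma disk_coeffs_bounded (a : nat -> C) :
  (forall n, Cmod (a n) <= 1) -> disk_coeffs a.
Proof.
  intros H rho Hr; exists 1; intros n.
  assert (P : 0 <= rho ^ n <= 1).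
  { split; [apply pow_le; lra|]. rewrite <- (pow1 n); apply pow_incr; lra. }
  specialize (H n); assert (Q := Cmod_ge_0 (a n)); nra.
Qed.

Lemma one_minus_neq_0 (z : C) : in_disk z -> (1 - z)%C <> RtoC 0.
Proof.
  intros Hz E; apply Ceq_minus in E; subst z; unfold in_disk in Hz; rewrite Cmod_1 in Hz; lra.
Qed.

Lemma CPSeries_geometric (z : C) : in_disk z -> CPSeries (fun _ => RtoC 1) z = (/ (1 - z))%C.
Proof.
  intros Hz; assert (N := one_minus_neq_0 z Hz).
  assert (H1 : disk_coeffs (fun _ => RtoC 1))
    by (apply disk_coeffs_bounded; intros _; rewrite Cmod_1; lra).
  apply (Cmult_eq_reg_l _ _ _ N); rewrite Cinv_r by exact N.
  assert (E := CPSeries_shift _ z H1 Hz); cbv beta in E.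
  set (p := CPSeries (fun _ => RtoC 1) z) in *.
  transitivity (p - z * p)%C; [ring|]. rewrite E at 1; ring.
Qed.

Definition log_series_coeffs (n : nat) : C :=
  match n with O => RtoC 0 | S _ => RtoC (- / INR n) end.

(** A holomorphic logarithm of [1 - z], identified with the principal one in
    [Clog_one_minus]; working with the series avoids differentiating the
    principal argument. *)
Definition log1m (z : C) : C := CPSeries log_series_coeffs z.

Lemma log_series_disk_coeffs : disk_coeffs log_series_coeffs.
Proof.
  apply disk_coeffs_bounded; intros [|n]; unfold log_series_coeffs; rewrite Cmod_R.
  - rewrite Rabs_R0; lra.
  - assert (P : 1 <= INR (S n)) by (rewrite S_INR; assert (Q := pos_INR n); lra).
    rewrite Rabs_Ropp, Rabs_pos_eq by (left; apply Rinv_0_lt_compat; lra).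
    rewrite <- Rinv_1; apply Rinv_le_contravar; lra.
Qed.

Lemma log1m_0 : log1m (RtoC 0) = RtoC 0.
Proof. apply (CPSeries_0 _ log_series_disk_coeffs). Qed.

Lemma is_cderive_log1m (z : C) : in_disk z -> is_cderive log1m z (- / (1 - z))%C.
Proof.
  intros Hz; eapply is_cderive_eq; [apply CPSeries_is_cderive; [apply log_series_disk_coeffs|exact Hz]|].
  rewrite (CPSeries_ext _ (fun _ => - RtoC 1 * RtoC 1)%C).
  - rewrite CPSeries_scal, CPSeries_geometric; [ring|exact Hz| |exact Hz].
    apply disk_coeffs_bounded; intros _; rewrite Cmod_1; lra.
  - intros n; unfold dcoeffs, log_series_coeffs; rewrite <- RtoC_mult, <- RtoC_opp, <- RtoC_mult.
    f_equal; field; apply not_0_INR; lia.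
Qed.

(** The quotient of the two sides has derivative 0. *)
Lemma Cexp_log1m (z : C) : in_disk z -> Cexp (log1m z) = (1 - z)%C.
Proof.
  intros Hz.
  assert (E : ((1 - z) * Cexp (- log1m z) = (1 - 0) * Cexp (- log1m 0))%C).
  { apply (cderive_zero_const (fun w => (1 - w) * Cexp (- log1m w))%C); [|exact Hz].
    intros w Hw; assert (N := one_minus_neq_0 w Hw); eapply is_cderive_eq.
    - apply is_cderive_mult.
      + apply is_cderive_minus; [apply is_cderive_const|apply is_cderive_id].
      + apply (is_cderive_comp Cexp (fun w => - log1m w)%C); [apply is_cderive_Cexp|].
        apply is_cderive_opp, is_cderive_log1m, Hw.
    - cbv beta; field; exact N. }
  rewrite log1m_0 in E. replace (- 0)%C with (RtoC 0) in E by ring.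
  rewrite Cexp_0 in E.
  transitivity (((1 - z) * Cexp (- log1m z)) * Cexp (log1m z))%C; [rewrite E; ring|].
  rewrite <- Cmult_assoc, Cexp_opp_l; ring.
Qed.

(** The imaginary part of the series cannot leave the principal strip: along
    a segment from the origin it would have to cross a value where the cosine,
    hence the real part of [1 - z], vanishes. Following the segment by a sine
    makes the path total. *)
Lemma Im_log1m_bound (z : C) : in_disk z -> - (PI / 2) < Im (log1m z) < PI / 2.
Proof.
  intros Hz.
  set (h := fun u => Im (log1m (RtoC (sin u) * z)%C)).
  assert (Hd : forall u, in_disk (RtoC (sin u) * z)%C).
  { intros u; unfold in_disk in *; rewrite Cmod_mult, Cmod_R.
    assert (B : Rabs (sin u) <= 1) by (apply Rabs_le, SIN_bound).
    assert (P := Cmod_ge_0 z). assert (Q := Rabs_pos (sin u)). nra. }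
  assert (Ch : continuity h).
  { intros u; apply continuity_pt_filterlim.
    apply (continuous_Im _ (fun u => log1m (RtoC (sin u) * z)%C)).
    apply (continuous_comp (fun u => RtoC (sin u) * z)%C log1m).
    - apply continuous_Cmult; [|apply continuous_const].
      apply continuous_RtoC, continuity_pt_filterlim, continuity_sin.
    - eapply is_cderive_continuous, is_cderive_log1m, Hd. }
  assert (Hcos : forall u, 0 < cos (h u)).
  { intros u; assert (E := f_equal Re (Cexp_log1m _ (Hd u))).
    assert (P := re_le_Cmod (RtoC (sin u) * z)%C). assert (D := Hd u); unfold in_disk in D.
    apply Rabs_le_between in P.
    assert (S1 : 0 < Re (Cexp (log1m (RtoC (sin u) * z)%C))).
    { rewrite E; unfold Cminus; rewrite re_plus, re_opp, re_RtoC; lra. }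
    apply Rmult_lt_reg_l with (1 := exp_pos (Re (log1m (RtoC (sin u) * z)%C))).
    rewrite Rmult_0_r; exact S1. }
  assert (H0 : h 0 = 0).
  { unfold h; rewrite sin_0, Cmult_0_l, log1m_0; reflexivity. }
  assert (H1 : h (PI / 2) = Im (log1m z)).
  { unfold h; rewrite sin_PI2, Cmult_1_l; reflexivity. }
  assert (P := PI_RGT_0). rewrite <- H1.
  assert (Cross : forall y, cos y = 0 -> ~ (Rmin (h 0) (h (PI / 2)) <= y <= Rmax (h 0) (h (PI / 2)))).
  { intros y Hy Hb; destruct (IVT_gen h 0 (PI / 2) y Ch Hb) as [u [_ Hu]].
    assert (Q := Hcos u); rewrite Hu, Hy in Q; lra. }
  rewrite H0 in Cross; split; apply Rnot_le_lt; intros L.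
  - apply (Cross (- (PI / 2))); [rewrite cos_neg; apply cos_PI2|].
    rewrite Rmin_right, Rmax_left by lra; lra.
  - apply (Cross (PI / 2)); [apply cos_PI2|].
    rewrite Rmin_left, Rmax_right by lra; lra.
Qed.

Lemma Clog_one_minus (z : C) : in_disk z -> Clog (1 - z)%C = log1m z.
Proof.
  intros Hz; assert (B := Im_log1m_bound z Hz). assert (P := PI_RGT_0).
  rewrite <- (Cexp_log1m z Hz); unfold Clog, Carg; rewrite Cmod_Cexp, ln_exp.
  set (l := log1m z) in *; assert (X := exp_pos (Re l)).
  replace (Re (Cexp l) / exp (Re l)) with (cos (Im l)) by (change (Re (Cexp l)) with (exp (Re l) * cos (Im l)); field; lra).
  replace (Im (Cexp l)) with (exp (Re l) * sin (Im l)) by reflexivity.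
  transitivity (Re l, Im l); [|symmetry; apply surjective_pairing].
  f_equal; destruct (Rle_dec 0 (exp (Re l) * sin (Im l))) as [S|S].
  - apply acos_cos; split; [|lra].
    apply Rnot_lt_le; intros L.
    assert (sin (Im l) < 0) by (apply sin_lt_0_var; lra). nra.
  - rewrite <- cos_neg, acos_cos; [ring|]. split; [|lra].
    apply Rnot_lt_le; intros L; apply S.
    assert (0 < sin (Im l)) by (apply sin_gt_0; lra). nra.
Qed.

(** The power [(1 - z)^(- c)]. *)
Definition extremal_derivative (c : R) (z : C) : C := Cexp (- RtoC c * log1m z)%C.

Lemma f_extremal_disk (c : R) (z : C) : in_disk z ->
  f_extremal c z = if Req_EM_T c 1 then (- log1m z)%C
                   else ((Cexp ((1 - c) * log1m z) - 1) / (c - 1))%C.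
Proof.
  intros Hz; unfold f_extremal, Cpower; rewrite Clog_one_minus by exact Hz; reflexivity.
Qed.

(** One exponent is absorbed by [Cexp (log1m z) = 1 - z]; this treats the
    logarithmic and the power case alike. *)
Lemma is_cderive_f_extremal (c : R) (z : C) :
  in_disk z -> is_cderive (f_extremal c) z (extremal_derivative c z).
Proof.
  intros Hz; assert (N := one_minus_neq_0 z Hz).
  assert (E : forall k, (Cexp (k * log1m z) = Cexp ((k - 1) * log1m z) * (1 - z))%C).
  { intros k; rewrite <- (Cexp_log1m z Hz), <- Cexp_plus; f_equal; ring. }
  eapply is_cderive_ext_disk;
    [intros w Hw; symmetry; apply (f_extremal_disk c w Hw)|exact Hz|].
  unfold extremal_derivative; destruct (Req_EM_T c 1) as [->|Hc].
  - eapply is_cderive_eq; [apply is_cderive_opp, is_cderive_log1m, Hz|].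
    apply (Cmult_eq_reg_l _ _ _ N).
    assert (E0 := E (RtoC 0)); rewrite Cmult_0_l, Cexp_0 in E0.
    replace (0 - 1)%C with (- RtoC 1)%C in E0 by ring.
    rewrite Cmult_comm, <- (Cmult_comm (Cexp _)), <- E0; field; exact N.
  - assert (Hc' : (RtoC c - 1)%C <> RtoC 0).
    { rewrite <- RtoC_minus; intros F; apply RtoC_inj in F; lra. }
    eapply is_cderive_eq.
    + apply is_cderive_mult; [|apply is_cderive_const].
      apply is_cderive_minus; [|apply is_cderive_const].
      apply (is_cderive_comp Cexp (fun w => (1 - c) * log1m w)%C); [apply is_cderive_Cexp|].
      apply is_cderive_mult; [apply is_cderive_const|apply is_cderive_log1m, Hz].
    + cbv beta; rewrite E.
      replace (1 - c - 1)%C with (- RtoC c)%C by ring.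
      field; split; assumption.
Qed.

Lemma is_cderive_extremal_derivative (c : R) (z : C) : in_disk z ->
  is_cderive (extremal_derivative c) z (extremal_derivative c z * (c / (1 - z)))%C.
Proof.
  intros Hz; assert (N := one_minus_neq_0 z Hz); eapply is_cderive_eq.
  - apply (is_cderive_comp Cexp (fun w => - RtoC c * log1m w)%C); [apply is_cderive_Cexp|].
    apply is_cderive_mult; [apply is_cderive_const|apply is_cderive_log1m, Hz].
  - unfold extremal_derivative; cbv beta; field; exact N.
Qed.

Lemma holo_f_extremal (c : R) : holo (f_extremal c).
Proof.
  exists (extremal_derivative c); intros z Hz; split; [now apply is_cderive_f_extremal|].
  eapply is_cderive_continuous, is_cderive_extremal_derivative, Hz.
Qed.

Lemma C_derive_f_extremal (c : R) (z : C) :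
  in_disk z -> C_derive (f_extremal c) z = extremal_derivative c z.
Proof. intros Hz; now apply is_C_derive_unique, is_cderive_f_extremal. Qed.

Lemma extremal_log_derivative (c : R) (z : C) : in_disk z ->
  (z * C_derive (C_derive (f_extremal c)) z / C_derive (f_extremal c) z)%C
  = (RtoC c * (z / (1 - z)))%C.
Proof.
  intros Hz.
  assert (E : C_derive (C_derive (f_extremal c)) z
     = (extremal_derivative c z * (c / (1 - z)))%C).
  { apply is_C_derive_unique, is_cderive_ext_disk with (extremal_derivative c); [|exact Hz|].
    - intros w Hw; symmetry; now apply C_derive_f_extremal.
    - now apply is_cderive_extremal_derivative. }
  rewrite E, C_derive_f_extremal by exact Hz; field.
  split; [now apply one_minus_neq_0|apply Cexp_neq_0].
Qed.

Lemma pow_n_Cpow (z : C) (n : nat) : @pow_n C_Ring z n = (z ^ n)%C.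
Proof. induction n as [|n IH]; [reflexivity|]. simpl; rewrite IH; reflexivity. Qed.

(** The largest disk about [z0] inside the unit disk is rescaled to the unit
    disk, where [holo_power_series] applies. *)
Lemma holo_analytic (f : C -> C) : holo f -> analytic_on_disk f.
Proof.
  intros [df Hf] z0 Hz0; unfold in_disk in Hz0.
  set (r := 1 - Cmod z0). assert (Hr : 0 < r) by (unfold r; lra).
  assert (Hd : forall v, in_disk v -> in_disk (z0 + RtoC r * v)%C).
  { intros v Hv; unfold in_disk in *.
    eapply Rle_lt_trans; [apply Cmod_triangle|].
    rewrite Cmod_mult, Cmod_RtoC_pos by lra. unfold r in *; nra. }
  destruct (holo_power_series (fun v => f (z0 + RtoC r * v)%C)) as [a [Ha Ea]].
  { exists (fun v => RtoC r * df (z0 + RtoC r * v))%C; intros v Hv.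
    destruct (Hf _ (Hd v Hv)) as [D Cd]; split.
    - apply (is_cderive_comp f (fun v => z0 + RtoC r * v)%C); [exact D|].
      eapply is_cderive_eq.
      + apply is_cderive_plus; [apply is_cderive_const|].
        apply is_cderive_mult; [apply is_cderive_const|apply is_cderive_id].
      + cbv beta; ring.
    - apply continuous_Cmult; [apply continuous_const|].
      apply (continuous_comp (fun v => z0 + RtoC r * v)%C df); [|exact Cd].
      apply continuous_Cplus; [apply continuous_const|].
      apply continuous_Cmult; [apply continuous_const|apply continuous_id]. }
  exists (fun n => RtoC (/ r) ^ n * a n)%C, r; split; [exact Hr|]; intros z Hz.
  set (v := (RtoC (/ r) * (z - z0))%C).
  assert (Hv : in_disk v).
  { unfold in_disk, v; rewrite Cmod_mult, Cmod_RtoC_pos by (left; now apply Rinv_0_lt_compat).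
    rewrite Rmult_comm; apply Rlt_div_l; lra. }
  assert (Ez : z = (z0 + RtoC r * v)%C).
  { unfold v; rewrite Cmult_assoc, <- RtoC_mult, Rinv_r by lra; ring. }
  assert (Ef : f z = CPSeries a v) by (rewrite <- (Ea v Hv), <- Ez; reflexivity).
  rewrite Ef.
  eapply (@is_series_ext C_AbsRing C_NormedModule); [|now apply CPSeries_is_series].
  intros n; change ((a n * v ^ n)%C = (@pow_n C_Ring (z - z0)%C n * (RtoC (/ r) ^ n * a n))%C).
  rewrite (pow_n_Cpow (z - z0)%C n); unfold v; rewrite Cpow_mult_l; ring.
Qed.

(** With [w = 1 - z] the claim is [Re (1 / w) > 1 / 2], which says that [w]
    lies in the disk of radius 1 about 1. *)
Lemma Re_z_over_one_minus (z : C) : in_disk z -> - (1 / 2) < Re (z / (1 - z))%C.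
Proof.
  intros Hz; assert (N := one_minus_neq_0 z Hz).
  replace (z / (1 - z))%C with (/ (1 - z) - 1)%C by (field; exact N).
  unfold Cminus at 1; rewrite re_plus, re_opp, re_RtoC.
  assert (M0 := Cmod_ge_0 z).
  assert (M1 : Cmod z ^ 2 < 1).
  { change (Cmod z < 1) in Hz; apply Rle_lt_trans with (Cmod z * 1); [|lra].
    simpl pow; apply Rmult_le_compat_l; lra. }
  rewrite Cmod2_alt in M1.
  assert (W : 0 < Cmod (1 - z)%C ^ 2) by (apply pow_lt; now apply Cmod_gt_0).
  rewrite Cmod2_alt in W.
  destruct z as [x y].
  change (x ^ 2 + y ^ 2 < 1) in M1. change (0 < (1 + - x) ^ 2 + (0 + - y) ^ 2) in W.
  change (- (1 / 2) < (1 + - x) / ((1 + - x) ^ 2 + (0 + - y) ^ 2) + - (1)).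
  assert (1 / 2 < (1 + - x) / ((1 + - x) ^ 2 + (0 + - y) ^ 2)); [|lra].
  apply -> Rlt_div_r; lra.
Qed.

Lemma f_extremal_0 (c : R) : f_extremal c (RtoC 0) = RtoC 0.
Proof.
  rewrite f_extremal_disk, log1m_0 by apply in_disk_0.
  destruct (Req_EM_T c 1) as [_|Hc]; [ring|].
  rewrite Cmult_0_r, Cexp_0; unfold Cdiv; ring.
Qed.

Lemma f_extremal_class_F (c : R) : 0 < c -> class_F c (f_extremal c).
Proof.
  intros Hc; split; [split; [|split]|].
  - apply holo_analytic, holo_f_extremal.
  - apply f_extremal_0.
  - rewrite C_derive_f_extremal by apply in_disk_0.
    unfold extremal_derivative; rewrite log1m_0, Cmult_0_r; apply Cexp_0.
  - intros z Hz; split.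
    + rewrite C_derive_f_extremal by exact Hz; apply Cexp_neq_0.
    + rewrite extremal_log_derivative, re_plus, re_RtoC, re_scal_l by exact Hz.
      assert (B := Re_z_over_one_minus z Hz); nra.
Qed.

Lemma Cexp_eq_1 (w : C) : Cexp w = RtoC 1 -> - PI < Im w < PI -> w = RtoC 0.
Proof.
  intros E B; assert (M := Cmod_Cexp w); rewrite E, Cmod_1 in M.
  assert (R0 : Re w = 0) by (apply exp_inv; rewrite exp_0; now symmetry).
  assert (S := f_equal Im E); unfold Cexp in S; simpl in S; rewrite R0, exp_0, Rmult_1_l in S.
  assert (I0 : Im w = 0).
  { destruct (Rtotal_order (Im w) 0) as [L|[Z|L]]; [|exact Z|].
    - assert (sin (Im w) < 0) by (apply sin_lt_0_var; lra). lra.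
    - assert (0 < sin (Im w)) by (apply sin_gt_0; lra). lra. }
  destruct w; simpl in *; now subst.
Qed.

(** Since [|1 - c| <= 2] and the imaginary part of the logarithm is less than
    [PI / 2] in modulus, the exponent [(1 - c) log (1 - z)] stays in the strip
    where [Cexp] takes the value 1 only at 0. *)
Lemma f_extremal_neq_0 (c : R) (z : C) :
  0 < c <= 3 -> in_disk z -> z <> RtoC 0 -> f_extremal c z <> RtoC 0.
Proof.
  intros Hc Hz Hz0 E; rewrite f_extremal_disk in E by exact Hz.
  assert (B := Im_log1m_bound z Hz). assert (P := PI_RGT_0).
  assert (L : log1m z = RtoC 0).
  { destruct (Req_EM_T c 1) as [_|Hc1].
    - replace (log1m z) with (- - log1m z)%C by ring; rewrite E; ring.
    - assert (Hc' : (RtoC c - 1)%C <> RtoC 0).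
      { rewrite <- RtoC_minus; intros F; apply RtoC_inj in F; lra. }
      assert (E1 : Cexp ((1 - c) * log1m z)%C = RtoC 1).
      { apply Ceq_minus; transitivity (((Cexp ((1 - c) * log1m z) - 1) / (c - 1)) * (c - 1))%C;
          [field; exact Hc'|rewrite E; ring]. }
      apply Cexp_eq_1 in E1.
      + apply (Cmult_eq_reg_l (1 - c)%C); [|rewrite E1; ring].
        intros F; apply Hc'; transitivity (- (1 - c))%C; [ring|rewrite F; ring].
      + rewrite <- RtoC_minus, im_scal_l; nra. }
  assert (X := Cexp_log1m z Hz); rewrite L, Cexp_0 in X.
  apply Hz0; transitivity (1 - (1 - z))%C; [ring|rewrite <- X; ring].
Qed.

(** With [g] the sum of the series [b], the logarithm of [g] is the primitive
    of [g' / g], integrated term by term. *)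
Lemma exists_log_coeffs (f : C -> C) (b : nat -> C) :
  disk_coeffs b -> b 0%nat = RtoC 1 ->
  (forall z, in_disk z -> CPSeries b z <> RtoC 0) ->
  (forall z, in_disk z -> f z = (z * CPSeries b z)%C) ->
  exists gamma, is_log_coeffs f gamma.
Proof.
  intros Hb Hb0 Hnz Hf.
  destruct (holo_power_series (fun z => CPSeries (dcoeffs b) z * / CPSeries b z)%C) as [d [Hd Ed]].
  { apply holo_mult; [now apply holo_CPSeries, disk_coeffs_dcoeffs|].
    apply holo_inv; [now apply holo_CPSeries|exact Hnz]. }
  set (l := fun n => match n with O => RtoC 0 | S m => (RtoC (/ INR n) * d m)%C end).
  assert (Hl : disk_coeffs l).
  { apply disk_coeffs_unshift, (disk_coeffs_le d _ Hd); intros n; unfold l.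
    assert (P : 1 <= INR (S n)) by (rewrite S_INR; assert (Q := pos_INR n); lra).
    rewrite Cmod_mult, Cmod_RtoC_pos by (left; apply Rinv_0_lt_compat; lra).
    rewrite <- (Rmult_1_l (Cmod (d n))) at 2.
    apply Rmult_le_compat_r; [apply Cmod_ge_0|].
    rewrite <- Rinv_1; apply Rinv_le_contravar; lra. }
  assert (Dl : forall z, CPSeries (dcoeffs l) z = CPSeries d z).
  { intros z; apply CPSeries_ext; intros n; unfold dcoeffs, l.
    rewrite Cmult_assoc, <- RtoC_mult, Rinv_r by (apply not_0_INR; lia); ring. }
  assert (El : forall z, in_disk z -> Cexp (CPSeries l z) = CPSeries b z).
  { intros z Hz.
    assert (E : (Cexp (- CPSeries l z) * CPSeries b z
                 = Cexp (- CPSeries l 0) * CPSeries b 0)%C).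
    { apply (cderive_zero_const (fun w => Cexp (- CPSeries l w) * CPSeries b w)%C); [|exact Hz].
      intros w Hw; eapply is_cderive_eq.
      - apply is_cderive_mult; [|now apply CPSeries_is_cderive].
        apply (is_cderive_comp Cexp (fun w => - CPSeries l w)%C); [apply is_cderive_Cexp|].
        now apply is_cderive_opp, CPSeries_is_cderive.
      - cbv beta; rewrite Dl, <- Ed by exact Hw; field; now apply Hnz. }
    rewrite !CPSeries_0, Hb0 in E by assumption.
    replace (- l 0%nat)%C with (RtoC 0) in E by (simpl; ring). rewrite Cexp_0 in E.
    transitivity (Cexp (CPSeries l z) * (Cexp (- CPSeries l z) * CPSeries b z))%C;
      [rewrite E; ring|].
    rewrite Cmult_assoc, (Cmult_comm (Cexp (CPSeries l z))), Cexp_opp_l; ring. }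
  exists (fun n => l n / 2)%C, (CPSeries l); split; [split; [|split]|].
  - intros z Hz; now apply CPSeries_continuous.
  - now rewrite CPSeries_0.
  - intros z Hz Hz0; rewrite El, Hf by exact Hz; field; exact Hz0.
  - intros z Hz.
    eapply (@is_series_ext C_AbsRing C_NormedModule);
      [|apply (@is_series_incr_1 C_AbsRing C_NormedModule (fun n => l n * z ^ n)%C)].
    + intros n; change ((l (S n) * z ^ S n)%C = (2 * (l (S n) / 2 * z ^ S n))%C); field.
    + change (@is_series C_AbsRing C_NormedModule (fun n => l n * z ^ n)%C
               (CPSeries l z + 0 * 1)%C).
      replace (CPSeries l z + 0 * 1)%C with (CPSeries l z) by ring.
      now apply CPSeries_is_series.
Qed.

Lemma f_extremal_log_coeffs (c : R) : 0 < c <= 3 ->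
  exists gamma a, is_log_coeffs (f_extremal c) gamma /\
    (forall n, (1 <= n)%nat -> a n = RtoC 1) /\ log_coeff_formulas c a gamma.
Proof.
  intros Hc.
  destruct (holo_power_series _ (holo_f_extremal c)) as [b [Hb Eb]].
  assert (Hsb := disk_coeffs_shift b Hb).
  assert (B0 : b 0%nat = RtoC 0).
  { rewrite <- (CPSeries_0 b Hb), <- Eb by apply in_disk_0; apply f_extremal_0. }
  assert (B1 : b 1%nat = RtoC 1).
  { transitivity (CPSeries (dcoeffs b) (RtoC 0)).
    - rewrite CPSeries_0 by (now apply disk_coeffs_dcoeffs); unfold dcoeffs; simpl; ring.
    - transitivity (C_derive (f_extremal c) (RtoC 0)).
      + symmetry; apply is_C_derive_unique, is_cderive_ext_disk with (CPSeries b);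
          [intros w Hw; symmetry; now apply Eb|apply in_disk_0|].
        apply CPSeries_is_cderive; [exact Hb|apply in_disk_0].
      + apply (f_extremal_class_F c); lra. }
  assert (Ef : forall z, in_disk z ->
     f_extremal c z = (z * CPSeries (fun n => b (S n)) z)%C).
  { intros z Hz; rewrite Eb, CPSeries_shift, B0 by assumption; ring. }
  destruct (exists_log_coeffs (f_extremal c) (fun n => b (S n)) Hsb B1) as [gamma Hg].
  { intros z Hz; destruct (Ceq_dec z (RtoC 0)) as [->|Hz0].
    - rewrite CPSeries_0, B1 by exact Hsb; apply C1_nz.
    - intros E; apply (f_extremal_neq_0 c z Hc Hz Hz0); rewrite Ef, E by exact Hz; ring. }
  { exact Ef. }
  destruct (class_F_log_coeffs c _ gamma (proj1 Hc) (f_extremal_class_F c (proj1 Hc)) Hg)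
    as [a [Ha [Ha0 [_ [Ea Fa]]]]].
  exists gamma, a; split; [exact Hg|split; [|exact Fa]].
  assert (Hc' : RtoC c <> RtoC 0) by (intros E; apply RtoC_inj in E; lra).
  set (o := fun n => match n with O => RtoC 0 | S _ => RtoC 1 end).
  assert (Ho : disk_coeffs o).
  { apply disk_coeffs_bounded; intros [|n]; unfold o; rewrite ?Cmod_0, ?Cmod_1; lra. }
  assert (Eo : forall n, a n = o n).
  { apply (CPSeries_inj a o Ha Ho); intros z Hz.
    apply (Cmult_eq_reg_l _ _ _ Hc').
    rewrite <- Ea, extremal_log_derivative, CPSeries_shift by assumption.
    unfold o at 1; change (fun n => o (S n)) with (fun _ : nat => RtoC 1).
    rewrite CPSeries_geometric by exact Hz; field; now apply one_minus_neq_0. }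
  intros [|n] Hn; [lia|apply Eo].
Qed.

(** The formulas have nonnegative value at [a = 1]: there the negative [c^4]
    terms are dominated by the [c^3] terms. *)
Lemma log_coeff_moduli_of_ones (c : R) (a gamma : nat -> C) :
  0 < c <= 3 -> (forall n, (1 <= n)%nat -> a n = RtoC 1) -> log_coeff_formulas c a gamma ->
  Cmod (gamma 1%nat) = c / 4 /\
  Cmod (gamma 2%nat) = 1 / 48 * (4 * c + c ^ 2) /\
  Cmod (gamma 3%nat) = 1 / 48 * (2 * c + c ^ 2) /\
  Cmod (gamma 4%nat) = 1 / 40 * (c + c ^ 2 / 18 * (13 + c / 2 - c ^ 2 / 8)) /\
  Cmod (gamma 5%nat) = 1 / 60 * (c + c ^ 2 / 12 * (11 + c - c ^ 2 / 4)).
Proof.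
  intros Hc H1 [F1 F2 F3 F4 F5].
  assert (A1 := H1 1%nat ltac:(lia)). assert (A2 := H1 2%nat ltac:(lia)).
  assert (A3 := H1 3%nat ltac:(lia)). assert (A4 := H1 4%nat ltac:(lia)).
  assert (A5 := H1 5%nat ltac:(lia)).
  rewrite A1 in F1; rewrite A1, A2 in F2; rewrite A1, A2, A3 in F3.
  rewrite A1, A2, A3, A4 in F4; rewrite A1, A2, A3, A4, A5 in F5.
  assert (K : forall (k x : R) (g : C), 0 < k -> 0 <= x -> (RtoC k * g)%C = RtoC x ->
     Cmod g = 1 / k * x).
  { intros k x g Hk Hx E; apply (f_equal Cmod) in E.
    rewrite Cmod_mult, !Cmod_RtoC_pos in E by lra.
    rewrite <- E; field; lra. }
  assert (C2 : 0 <= c ^ 2) by apply pow2_ge_0.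
  assert (C3 : 0 <= c ^ 2 * (3 - c)) by (apply Rmult_le_pos; lra).
  split; [|split; [|split; [|split]]].
  - rewrite (K 4 c); [field|lra|lra|]. rewrite F1; ring.
  - apply K; [lra|lra|]. rewrite F2, RtoC_plus, RtoC_mult, RtoC_pow; ring.
  - apply K; [lra|lra|]. rewrite F3, RtoC_plus, RtoC_mult, RtoC_pow; ring.
  - apply K; [lra| |].
    + assert (0 <= c ^ 2 / 18 * (13 + c / 2 - c ^ 2 / 8)) by (apply Rmult_le_pos; nra). lra.
    + rewrite F4, RtoC_plus, RtoC_mult, RtoC_minus, RtoC_plus, !RtoC_div, RtoC_pow by lra; field.
  - apply K; [lra| |].
    + assert (0 <= c ^ 2 / 12 * (11 + c - c ^ 2 / 4)) by (apply Rmult_le_pos; nra). lra.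
    + rewrite F5, RtoC_plus, RtoC_mult, RtoC_minus, RtoC_plus, !RtoC_div, RtoC_pow by lra; field.
Qed.

Theorem theorem2p7 (c : R) (hc : 0 < c <= 3) :
  (forall (f : C -> C) (gamma : nat -> C),
     class_F c f -> is_log_coeffs f gamma ->
     Cmod (gamma 1%nat) <= c / 4 /\
     Cmod (gamma 2%nat) <= 1 / 48 * (4 * c + c ^ 2) /\
     Cmod (gamma 3%nat) <= 1 / 48 * (2 * c + c ^ 2) /\
     (c <= 144 / 55 ->
      Cmod (gamma 4%nat) <=
        1 / 40 * (c + c ^ 2 / 18 * (13 + c / 2 - c ^ 2 / 8))) /\
     (2.71569 < c ->
      Cmod (gamma 4%nat) <=
        1 / 40 * (c + 2 * c ^ 2 / 9 + c ^ 2 / 2 * M2 c)) /\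
     (c <= 80 / 61 ->
      Cmod (gamma 5%nat) <=
        1 / 60 * (c + c ^ 2 / 12 * (11 + c - c ^ 2 / 4))) /\
     (1.35541 < c ->
      Cmod (gamma 5%nat) <=
        1 / 60 * (c + c ^ 2 / 2 + c ^ 3 / 24 + 5 * c ^ 2 / 12 * M3 c))) /\
  (class_F c (f_extremal c) /\
   exists gamma : nat -> C, is_log_coeffs (f_extremal c) gamma /\
     Cmod (gamma 1%nat) = c / 4 /\
     Cmod (gamma 2%nat) = 1 / 48 * (4 * c + c ^ 2) /\
     Cmod (gamma 3%nat) = 1 / 48 * (2 * c + c ^ 2)) /\
  (c <= 144 / 55 ->
   is_lub (log_coeff_moduli c 4)
     (1 / 40 * (c + c ^ 2 / 18 * (13 + c / 2 - c ^ 2 / 8)))) /\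
  (c <= 80 / 61 ->
   is_lub (log_coeff_moduli c 5)
     (1 / 60 * (c + c ^ 2 / 12 * (11 + c - c ^ 2 / 4)))).
Proof.
  assert (Hext := f_extremal_class_F c (proj1 hc)).
  destruct (f_extremal_log_coeffs c hc) as [g [o [Hg [Ho Fo]]]].
  assert (Ev : Cmod (g 1%nat) = c / 4 /\
     Cmod (g 2%nat) = 1 / 48 * (4 * c + c ^ 2) /\
     Cmod (g 3%nat) = 1 / 48 * (2 * c + c ^ 2) /\
     Cmod (g 4%nat) = 1 / 40 * (c + c ^ 2 / 18 * (13 + c / 2 - c ^ 2 / 8)) /\
     Cmod (g 5%nat) = 1 / 60 * (c + c ^ 2 / 12 * (11 + c - c ^ 2 / 4)))
    by (apply (log_coeff_moduli_of_ones c o g hc Ho Fo)).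
  destruct Ev as [E1 [E2 [E3 [E4 E5]]]].
  split; [|split; [|split]].
  - intros f gamma Hf Hgam.
    destruct (class_F_log_coeffs c f gamma (proj1 hc) Hf Hgam) as [a [Ha [Ha0 [Hpos [_ Fa]]]]].
    assert (Hm := positive_real_part_moment_bounds a Ha Ha0 Hpos).
    destruct (gamma_low_bounds c a gamma hc Hm Fa) as [B1 [B2 B3]].
    assert (B4 := gamma4_bound c a gamma hc Hm Fa).
    assert (B5 := gamma5_bound c a gamma hc Hm Fa).
    assert (Pc : 0 <= c ^ 2) by apply pow2_ge_0.
    split; [exact B1|split; [exact B2|split; [exact B3|]]].
    split; [intros _; exact B4|split; [|split; [intros _; exact B5|]]]; intros Hc.
    + assert (V := Rmult_le_compat_l _ _ _ Pc (M2_ge c (conj Hc (proj2 hc)))). lra.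
    + assert (V := Rmult_le_compat_l _ _ _ Pc (M3_ge c (conj Hc (proj2 hc)))). lra.
  - split; [exact Hext|]. exists g; auto.
  - intros _; rewrite <- E4; split.
    + intros x [f [gamma [Hf [Hgam ->]]]].
      destruct (class_F_log_coeffs c f gamma (proj1 hc) Hf Hgam) as [a [Ha [Ha0 [Hpos [_ Fa]]]]].
      rewrite E4; apply (gamma4_bound c a gamma hc); [|exact Fa].
      now apply positive_real_part_moment_bounds.
    + intros b Hb; apply Hb; now exists (f_extremal c), g.
  - intros _; rewrite <- E5; split.
    + intros x [f [gamma [Hf [Hgam ->]]]].
      destruct (class_F_log_coeffs c f gamma (proj1 hc) Hf Hgam) as [a [Ha [Ha0 [Hpos [_ Fa]]]]].
      rewrite E5; apply (gamma5_bound c a gamma hc); [|exact Fa].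
      now apply positive_real_part_moment_bounds.
    + intros b Hb; apply Hb; now exists (f_extremal c), g.
Qed.
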